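(* Let $T$ be a recursively enumerable theory with $T\supseteq\mathsf{Q}$. Suppose that for all $m,n,k\in\mathbb{N}$ we have $$T\vdash\mathsf{Pr}_T({\sf D}(k,m))\wedge\mathsf{Pr}_T({\sf D}(k,n))\wedge\overline{m}\neq\overline{n}\rightarrow\neg\mathsf{Con}(T),$$ and that the theory $T+\mathsf{Con}(T)$ is consistent. Then there exists $b\in\mathbb{N}$ such that $\neg\mathsf{Def}_T^{<\overline{5}\cdot\overline{\ell_T}}(\overline{b})$ is independent from $T$, and $\mathsf{Boolos}_T(\overline{b})$ is also independent from $T$.
   Context: Formulas of arithmetic are Gödel-coded in a standard way. Variables are $x,x',x'',\dots$, of lengths $1,2,3,\dots$. The length of a formula (or of its code) is denoted $\mathsf{len}$, and for each $k$ there are finitely many formulas of length $k$. The numeral $\overline{m}$ is $\mathsf{s}(\cdots\mathsf{s}(0)\cdots)$, with $m$ occurrences of $\mathsf{s}$, and has length $3m+1$. $\mathsf{Pr}_T(x)$ is the standard provability predicate of $T$, and $\mathsf{Con}(T)=\neg\mathsf{Pr}_T(\bot)$. For a formula $\psi(x_1,\dots,x_m)$ (with code $k$) and a number $n$, ${\sf D}(k,n)$ is the Gödel code of $\forall x[\psi(x,\dots,x)\leftrightarrow x=\overline{n}]$; this is formalized as a function in arithmetic. Define the following formulas: - $\mathsf{Def}_T^{<z}(y)$ is $\exists x[\mathsf{len}(x)<z\wedge\mathsf{Pr}_T({\sf D}(x,y))]$. - $\mathsf{Berry}_T^{<v}(u)$ is $\neg\mathsf{Def}_T^{<v}(u)\wedge\forall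 y<u\,\mathsf{Def}_T^{<v}(y)$. - $\mathsf{Boolos}_T(x)$ is $\exists x'[x'=\overline{5}\cdot\overline{\ell_T}\wedge\mathsf{Berry}_T^{<x'}(x)]$, where $\ell_T$ is the length of the formula $\mathsf{Berry}_T^{<x'}(x)$. A sentence is independent from $T$ if neither it nor its negation is provable in $T$. $\mathsf{Q}$ is Robinson's arithmetic. *)

(* Defs.v *)
From Stdlib Require List.
From mathcomp Require Import all_boot.

Set Implicit Arguments.
Unset Strict Implicit.
Unset Printing Implicit Defensive.

(** * First-order arithmetic

    De Bruijn syntax: [Var i] is the [i]-th of the variables x, x', x'', ...,
    and a quantifier binds index 0 of its body. *)

Inductive tm : Type :=
| Var of nat
| Zero
| Succ of tm
| Add of tm & tm
| Mul of tm & tm.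

Inductive fm : Type :=
| Bot
| Eq of tm & tm
| Imp of fm & fm
| And of fm & fm
| Or of fm & fm
| All of fm
| Ex of fm.

Notation "$ i" := (Var i) (at level 1, i at level 0, format "$ i").

Definition Not (A : fm) : fm := Imp A Bot.
Definition Iff (A B : fm) : fm := And (Imp A B) (Imp B A).

Definition scons (X : Type) (x : X) (s : nat -> X) (i : nat) : X :=
  if i is j.+1 then s j else x.

Fixpoint subst_tm (s : nat -> tm) (t : tm) : tm :=
  match t with
  | Var i => s i
  | Zero => Zero
  | Succ t => Succ (subst_tm s t)
  | Add t u => Add (subst_tm s t) (subst_tm s u)
  | Mul t u => Mul (subst_tm s t) (subst_tm s u)
  end.

Definition shift_tm : tm -> tm := subst_tm (fun i => Var i.+1).

Definition up (s : nat -> tm) : nat -> tm :=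
  scons (Var 0) (fun i => shift_tm (s i)).

Fixpoint subst_fm (s : nat -> tm) (A : fm) : fm :=
  match A with
  | Bot => Bot
  | Eq t u => Eq (subst_tm s t) (subst_tm s u)
  | Imp A B => Imp (subst_fm s A) (subst_fm s B)
  | And A B => And (subst_fm s A) (subst_fm s B)
  | Or A B => Or (subst_fm s A) (subst_fm s B)
  | All A => All (subst_fm (up s) A)
  | Ex A => Ex (subst_fm (up s) A)
  end.

Definition shift_fm : fm -> fm := subst_fm (fun i => Var i.+1).
(* The body of a quantifier, instantiated with [t]. *)
Definition inst (t : tm) : fm -> fm := subst_fm (scons t Var).
(* psi(x, ..., x) *)
Definition diag : fm -> fm := subst_fm (fun _ => Var 0).

(* All free variables have index < n. *)
Fixpoint tm_below (n : nat) (t : tm) : bool :=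
  match t with
  | Var i => i < n
  | Zero => true
  | Succ t => tm_below n t
  | Add t u | Mul t u => tm_below n t && tm_below n u
  end.

Fixpoint fm_below (n : nat) (A : fm) : bool :=
  match A with
  | Bot => true
  | Eq t u => tm_below n t && tm_below n u
  | Imp A B | And A B | Or A B => fm_below n A && fm_below n B
  | All A | Ex A => fm_below n.+1 A
  end.

Definition sentence (A : fm) : bool := fm_below 0 A.

Definition numeral (n : nat) : tm := iter n Succ Zero.

Definition ltf (t u : tm) : fm :=
  Ex (Eq (Add $0 (Succ (shift_tm t))) (shift_tm u)).
Definition lef (t u : tm) : fm := ltf t (Succ u).
Definition ball (t : tm) (A : fm) : fm := All (Imp (ltf $0 (shift_tm t)) A).
Definition bex (t : tm) (A : fm) : fm := Ex (And (ltf $0 (shift_tm t)) A).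

(** Number of symbols.  The variable with index [i] counts [i.+1]; [s(t)],
    [(t + u)], [(t * u)], [[A -> B]], [[A /\ B]], [[A \/ B]] are written with
    their brackets.  A quantifier counts as two symbols, itself and its bound
    variable, whose de Bruijn index is 0. *)
Fixpoint len_tm (t : tm) : nat :=
  match t with
  | Var i => i.+1
  | Zero => 1
  | Succ t => len_tm t + 3
  | Add t u | Mul t u => len_tm t + len_tm u + 3
  end.

Fixpoint len_fm (A : fm) : nat :=
  match A with
  | Bot => 1
  | Eq t u => len_tm t + len_tm u + 1
  | Imp A B | And A B | Or A B => len_fm A + len_fm B + 3
  | All A | Ex A => len_fm A + 2
  end.

(** * Theories and provability *)

Definition theory := fm -> Prop.

Inductive logax : fm -> Prop :=
| lK A B : logax (Imp A (Imp B A))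
| lS A B C :
    logax (Imp (Imp A (Imp B C)) (Imp (Imp A B) (Imp A C)))
| lDN A : logax (Imp (Imp (Imp A Bot) Bot) A)
| lAndI A B : logax (Imp A (Imp B (And A B)))
| lAndEl A B : logax (Imp (And A B) A)
| lAndEr A B : logax (Imp (And A B) B)
| lOrIl A B : logax (Imp A (Or A B))
| lOrIr A B : logax (Imp B (Or A B))
| lOrE A B C :
    logax (Imp (Imp A C) (Imp (Imp B C) (Imp (Or A B) C)))
| lAllE A t : logax (Imp (All A) (inst t A))
| lAllI A B : logax (Imp (All (Imp (shift_fm A) B)) (Imp A (All B)))
| lExI A t : logax (Imp (inst t A) (Ex A))
| lExE A B : logax (Imp (All (Imp A (shift_fm B))) (Imp (Ex A) B))
| lEqR t : logax (Eq t t)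
| lEqL A t u : logax (Imp (Eq t u) (Imp (inst t A) (inst u A))).

Inductive prv (T : theory) : fm -> Prop :=
| pAx A : T A -> prv T A
| pLog A : logax A -> prv T A
| pMP A B : prv T (Imp A B) -> prv T A -> prv T B
| pGen A : prv T A -> prv T (All A).

Definition consistent (T : theory) : Prop := ~ prv T Bot.
Definition extends (T U : theory) : Prop := forall A, prv U A -> prv T A.
Definition add_axiom (T : theory) (A : fm) : theory := fun B => T B \/ B = A.
Definition independent (T : theory) (A : fm) : Prop :=
  ~ prv T A /\ ~ prv T (Not A).

(* Robinson arithmetic *)
Inductive Q : theory :=
| Q1 : Q (All (Not (Eq (Succ $0) Zero)))
| Q2 : Q (All (All (Imp (Eq (Succ $0) (Succ $1)) (Eq $0 $1))))
| Q3 : Q (All (Imp (Not (Eq $0 Zero)) (Ex (Eq $1 (Succ $0)))))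
| Q4 : Q (All (Eq (Add $0 Zero) $0))
| Q5 : Q (All (All (Eq (Add $0 (Succ $1)) (Succ (Add $0 $1)))))
| Q6 : Q (All (Eq (Mul $0 Zero) Zero))
| Q7 : Q (All (All (Eq (Mul $0 (Succ $1)) (Add (Mul $0 $1) $0)))).

(** * The standard model and the arithmetical hierarchy *)

Fixpoint eval (r : nat -> nat) (t : tm) : nat :=
  match t with
  | Var i => r i
  | Zero => 0
  | Succ t => (eval r t).+1
  | Add t u => eval r t + eval r u
  | Mul t u => eval r t * eval r u
  end.

Fixpoint sat (r : nat -> nat) (A : fm) : Prop :=
  match A with
  | Bot => False
  | Eq t u => eval r t = eval r u
  | Imp A B => sat r A -> sat r B
  | And A B => sat r A /\ sat r B
  | Or A B => sat r A \/ sat r B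
  | All A => forall n, sat (scons n r) A
  | Ex A => exists n, sat (scons n r) A
  end.

Inductive delta0 : fm -> Prop :=
| dBot : delta0 Bot
| dEq t u : delta0 (Eq t u)
| dImp A B : delta0 A -> delta0 B -> delta0 (Imp A B)
| dAnd A B : delta0 A -> delta0 B -> delta0 (And A B)
| dOr A B : delta0 A -> delta0 B -> delta0 (Or A B)
| dBall t A : delta0 A -> delta0 (ball t A)
| dBex t A : delta0 A -> delta0 (bex t A).

Inductive sigma1 : fm -> Prop :=
| sDelta A : delta0 A -> sigma1 A
| sEx A : sigma1 A -> sigma1 (Ex A).

(** * Goedel codes *)

(* An injective pairing that is a term of the language. *)
Definition npair (m n : nat) : nat := (m + n) * (m + n) + m.

Fixpoint code_tm (t : tm) : nat :=
  match t with
  | Var i => npair 0 i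
  | Zero => npair 1 0
  | Succ t => npair 2 (code_tm t)
  | Add t u => npair 3 (npair (code_tm t) (code_tm u))
  | Mul t u => npair 4 (npair (code_tm t) (code_tm u))
  end.

Fixpoint code (A : fm) : nat :=
  match A with
  | Bot => npair 5 0
  | Eq t u => npair 6 (npair (code_tm t) (code_tm u))
  | Imp A B => npair 7 (npair (code A) (code B))
  | And A B => npair 8 (npair (code A) (code B))
  | Or A B => npair 9 (npair (code A) (code B))
  | All A => npair 10 (code A)
  | Ex A => npair 11 (code A)
  end.

Definition codes (T : theory) (n : nat) : Prop := exists2 A, T A & n = code A.

(** * Recursive enumerability *)

(* Kleene's partial recursive functions and their graphs. *)
Inductive recf : Type :=
| rZero
| rSucc
| rProj of nat
| rComp of recf & seq recf
| rPrim of recf & recf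
| rMu of recf.

Inductive reval : recf -> seq nat -> nat -> Prop :=
| evZero xs : reval rZero xs 0
| evSucc x xs : reval rSucc (x :: xs) x.+1
| evProj i xs : i < size xs -> reval (rProj i) xs (nth 0 xs i)
| evComp f gs xs ys y :
    List.Forall2 (fun g z => reval g xs z) gs ys -> reval f ys y ->
    reval (rComp f gs) xs y
| evPrim0 f g xs y : reval f xs y -> reval (rPrim f g) (0 :: xs) y
| evPrimS f g n xs z y :
    reval (rPrim f g) (n :: xs) z -> reval g [:: n, z & xs] y ->
    reval (rPrim f g) (n.+1 :: xs) y
| evMu f xs n :
    reval f (n :: xs) 0 ->
    (forall m, m < n -> exists v, reval f (m :: xs) v.+1) ->
    reval (rMu f) xs n.

Definition re_set (P : nat -> Prop) : Prop :=
  exists f : recf, forall n, P n <-> exists y, reval f [:: n] y.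

Definition re_theory (T : theory) : Prop :=
  (forall A, T A -> sentence A) /\ re_set (codes T).

(* [tau] is a Sigma_1 formula, in the single variable [$0], that defines the
   set of axioms of [T] in the standard model; a provability predicate of [T]
   is built from such a formula. *)
Definition presents (tau : fm) (T : theory) : Prop :=
  [/\ sigma1 tau, fm_below 1 tau
    & forall n, sat (fun _ => n) tau <-> codes T n].

(** * Arithmetization

    A formula with parameters is a formula with free variables [$0], [$1], ...,
    applied to terms by [F @@ ts]. *)

Definition app (F : fm) (ts : seq tm) : fm := subst_fm (nth Zero ts) F.
Notation "F @@ ts" := (app F ts) (at level 35, no associativity).

Definition exs (n : nat) (A : fm) : fm := iter n Ex A.
Definition ands (As : seq fm) : fm := foldr And (Not Bot) As.
Definition ors (As : seq fm) : fm := foldr Or Bot As.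

Fixpoint balls (n : nat) (t : tm) (A : fm) : fm :=
  if n is n'.+1 then ball t (balls n' (shift_tm t) A) else A.

Definition cpair (t u : tm) : tm := Add (Mul (Add t u) (Add t u)) t.
Definition cun (k : nat) (t : tm) : tm := cpair (numeral k) t.
Definition cbin (k : nat) (t u : tm) : tm := cpair (numeral k) (cpair t u).

Definition cVar := cun 0.
Definition cZero := cun 1 Zero.
Definition cSucc := cun 2.
Definition cBot := cun 5 Zero.
Definition cEq := cbin 6.
Definition cImp := cbin 7.
Definition cAnd := cbin 8.
Definition cOr := cbin 9.
Definition cAll := cun 10.
Definition cEx := cun 11.

(** Finite sets of tuples.  The triple [a, b, d] codes the set of those tuples
    [ts] of numbers < d such that [1 + (<ts> + 1) * b] divides [a], where [<ts>]
    is an iterated pair.  Every finite set has such a code: take for [b] a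
    suitable factorial, which makes these moduli pairwise coprime, and for [a]
    a product of them. *)
Definition tmem (ts : seq tm) (a b d : tm) : fm :=
  And (ands [seq ltf t d | t <- ts])
      (bex (Succ a)
         (Eq (Mul $0 (Succ (Mul (Succ (shift_tm (foldr cpair Zero ts)))
                                (shift_tm b))))
             (shift_tm a))).

(** [lfp k step] has the free variables [$0 ... $(k-1)].  It says that this
    [k]-tuple belongs to some finite set of [k]-tuples, every member of which is
    justified, in the sense of [step], by members of the same set.  In [step] the
    tuple is [$0 ... $(k-1)] and the set is [$k, $(k+1), $(k+2)]; under [e]
    further binders, membership in the set is [rec k e ts].  Whenever the
    justifications decrease some measure, the relation defined is the
    inductive relation generated by [step]. *)
Definition rec (k e : nat) (ts : seq tm) : fm :=
  tmem ts (Var (k + e)) (Var (k + e).+1) (Var (k + e).+2).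

Definition lfp (k : nat) (step : fm) : fm :=
  exs 3 (And (tmem [seq Var i | i <- iota 3 k] $0 $1 $2)
             (balls k $2 (Imp (rec k 0 [seq Var i | i <- iota 0 k]) step))).

(** ** Length *)

(* (x, y): x is the code of a term of length y *)
Definition len_tm_f : fm := lfp 2 (ors [::
  exs 1 (let n := $0 in let x := $1 in let y := $2 in
    And (Eq x (cVar n)) (Eq y (Succ n)));
  (let x := $0 in let y := $1 in
    And (Eq x cZero) (Eq y (numeral 1)));
  exs 2 (let t := $0 in let l := $1 in let x := $2 in let y := $3 in
    ands [:: rec 2 2 [:: t; l]; Eq x (cSucc t); Eq y (Add l (numeral 3))]);
  exs 4 (let t := $0 in let u := $1 in let l := $2 in let m := $3 in
         let x := $4 in let y := $5 in
    ands [:: rec 2 4 [:: t; l]; rec 2 4 [:: u; m];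
             ors [seq Eq x (cbin k t u) | k <- [:: 3; 4]];
             Eq y (Add (Add l m) (numeral 3))])]).

(* (x, y): x is the code of a formula of length y *)
Definition len_fm_f : fm := lfp 2 (ors [::
  (let x := $0 in let y := $1 in
    And (Eq x cBot) (Eq y (numeral 1)));
  exs 4 (let t := $0 in let u := $1 in let l := $2 in let m := $3 in
         let x := $4 in let y := $5 in
    ands [:: len_tm_f @@ [:: t; l]; len_tm_f @@ [:: u; m];
             Eq x (cEq t u); Eq y (Add (Add l m) (numeral 1))]);
  exs 4 (let f := $0 in let g := $1 in let l := $2 in let m := $3 in
         let x := $4 in let y := $5 in
    ands [:: rec 2 4 [:: f; l]; rec 2 4 [:: g; m];
             ors [seq Eq x (cbin k f g) | k <- [:: 7; 8; 9]];
             Eq y (Add (Add l m) (numeral 3))]);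
  exs 2 (let f := $0 in let l := $1 in let x := $2 in let y := $3 in
    ands [:: rec 2 2 [:: f; l]; ors [seq Eq x (cun k f) | k <- [:: 10; 11]];
             Eq y (Add l (numeral 2))])]).

Definition is_tm (t : tm) : fm := Ex (len_tm_f @@ [:: shift_tm t; $0]).
Definition is_fm (t : tm) : fm := Ex (len_fm_f @@ [:: shift_tm t; $0]).

(* len(x) < z *)
Definition len_lt (x z : tm) : fm :=
  Ex (And (len_fm_f @@ [:: shift_tm x; $0]) (ltf $0 (shift_tm z))).

(** ** Substitution

    [map_tm_f V] and [map_fm_f V], in the variables (x, c, p, y), say that y
    results from x by a substitution of variables described by [V]; c is the
    number of binders passed so far and p a parameter.  [V], in the variables
    (n, c, p, y), gives the image y, under c binders, of the variable n. *)

Definition map_tm_f (V : fm) : fm := lfp 4 (ors [::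
  exs 1 (let n := $0 in
         let x := $1 in let c := $2 in let p := $3 in let y := $4 in
    And (Eq x (cVar n)) (V @@ [:: n; c; p; y]));
  (let x := $0 in let y := $3 in
    And (Eq x cZero) (Eq y cZero));
  exs 2 (let t := $0 in let t' := $1 in
         let x := $2 in let c := $3 in let p := $4 in let y := $5 in
    ands [:: rec 4 2 [:: t; c; p; t']; Eq x (cSucc t); Eq y (cSucc t')]);
  exs 4 (let t := $0 in let u := $1 in let t' := $2 in let u' := $3 in
         let x := $4 in let c := $5 in let p := $6 in let y := $7 in
    ands [:: rec 4 4 [:: t; c; p; t']; rec 4 4 [:: u; c; p; u'];
             ors [seq And (Eq x (cbin k t u)) (Eq y (cbin k t' u'))
                 | k <- [:: 3; 4]]])]).

Definition map_fm_f (V : fm) : fm := lfp 4 (ors [::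
  (let x := $0 in let y := $3 in
    And (Eq x cBot) (Eq y cBot));
  exs 4 (let t := $0 in let u := $1 in let t' := $2 in let u' := $3 in
         let x := $4 in let c := $5 in let p := $6 in let y := $7 in
    ands [:: map_tm_f V @@ [:: t; c; p; t']; map_tm_f V @@ [:: u; c; p; u'];
             Eq x (cEq t u); Eq y (cEq t' u')]);
  exs 4 (let f := $0 in let g := $1 in let f' := $2 in let g' := $3 in
         let x := $4 in let c := $5 in let p := $6 in let y := $7 in
    ands [:: rec 4 4 [:: f; c; p; f']; rec 4 4 [:: g; c; p; g'];
             ors [seq And (Eq x (cbin k f g)) (Eq y (cbin k f' g'))
                 | k <- [:: 7; 8; 9]]]);
  exs 2 (let f := $0 in let f' := $1 in
         let x := $2 in let c := $3 in let p := $4 in let y := $5 in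
    ands [:: rec 4 2 [:: f; Succ c; p; f'];
             ors [seq And (Eq x (cun k f)) (Eq y (cun k f'))
                 | k <- [:: 10; 11]]])]).

(* n |-> n + c *)
Definition lift_var : fm :=
  let n := $0 in let c := $1 in let y := $3 in Eq y (cVar (Add n c)).

Definition shift_var : fm :=
  let n := $0 in let c := $1 in let y := $3 in
  Or (And (ltf n c) (Eq y (cVar n))) (And (lef c n) (Eq y (cVar (Succ n)))).

Definition diag_var : fm :=
  let n := $0 in let c := $1 in let y := $3 in
  Or (And (ltf n c) (Eq y (cVar n))) (And (lef c n) (Eq y (cVar c))).

(* p is the code of the instantiating term *)
Definition inst_var : fm :=
  let n := $0 in let c := $1 in let p := $2 in let y := $3 in
  ors [:: And (ltf n c) (Eq y (cVar n));
          And (Eq n c) (map_tm_f lift_var @@ [:: p; c; Zero; y]);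
          Ex (let m := $0 in let n := $1 in let c := $2 in let y := $4 in
            ands [:: Eq n (Succ m); lef c m; Eq y (cVar m)])].

(* y codes the result of [shift_fm], [diag], [inst] on the formula coded by x *)
Definition shift_f (x y : tm) : fm := map_fm_f shift_var @@ [:: x; Zero; Zero; y].
Definition diag_f (x y : tm) : fm := map_fm_f diag_var @@ [:: x; Zero; Zero; y].
Definition inst_f (p x y : tm) : fm := map_fm_f inst_var @@ [:: x; Zero; p; y].

(** ** Provability *)

(* (x): x is the code of a logical axiom *)
Definition logax_f : fm := ors [::
  exs 2 (let f := $0 in let g := $1 in let x := $2 in
    ands [:: is_fm f; is_fm g; Eq x (cImp f (cImp g f))]);
  exs 3 (let f := $0 in let g := $1 in let h := $2 in let x := $3 in
    ands [:: is_fm f; is_fm g; is_fm h;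
             Eq x (cImp (cImp f (cImp g h)) (cImp (cImp f g) (cImp f h)))]);
  exs 1 (let f := $0 in let x := $1 in
    And (is_fm f) (Eq x (cImp (cImp (cImp f cBot) cBot) f)));
  exs 2 (let f := $0 in let g := $1 in let x := $2 in
    ands [:: is_fm f; is_fm g;
             ors [seq Eq x z | z <- [:: cImp f (cImp g (cAnd f g));
                                        cImp (cAnd f g) f; cImp (cAnd f g) g;
                                        cImp f (cOr f g); cImp g (cOr f g)]]]);
  exs 3 (let f := $0 in let g := $1 in let h := $2 in let x := $3 in
    ands [:: is_fm f; is_fm g; is_fm h;
             Eq x (cImp (cImp f h) (cImp (cImp g h) (cImp (cOr f g) h)))]);
  exs 3 (let f := $0 in let t := $1 in let f' := $2 in let x := $3 in
    ands [:: is_fm f; is_tm t; inst_f t f f';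
             Or (Eq x (cImp (cAll f) f')) (Eq x (cImp f' (cEx f)))]);
  exs 3 (let f := $0 in let g := $1 in let f' := $2 in let x := $3 in
    ands [:: is_fm f; is_fm g; shift_f f f';
             Or (Eq x (cImp (cAll (cImp f' g)) (cImp f (cAll g))))
                (Eq x (cImp (cAll (cImp g f')) (cImp (cEx g) f)))]);
  exs 1 (let t := $0 in let x := $1 in
    And (is_tm t) (Eq x (cEq t t)));
  exs 5 (let f := $0 in let t := $1 in let u := $2 in
         let f' := $3 in let f'' := $4 in let x := $5 in
    ands [:: is_fm f; is_tm t; is_tm u; inst_f t f f'; inst_f u f f'';
             Eq x (cImp (cEq t u) (cImp f' f''))])].

(* (x, i): x is line i of a Hilbert-style proof from the axioms defined by tau;
   every line is an axiom or is inferred from lines with smaller numbers *)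
Definition proof_line_f (tau : fm) : fm := lfp 2 (ors [::
  tau @@ [:: $0];
  logax_f @@ [:: $0];
  exs 3 (let f := $0 in let i1 := $1 in let i2 := $2 in
         let x := $3 in let i := $4 in
    ands [:: ltf i1 i; ltf i2 i;
             rec 2 3 [:: cImp f x; i1]; rec 2 3 [:: f; i2]]);
  exs 2 (let f := $0 in let i1 := $1 in let x := $2 in let i := $3 in
    ands [:: ltf i1 i; rec 2 2 [:: f; i1]; Eq x (cAll f)])]).

Definition Pr (tau : fm) (t : tm) : fm :=
  Ex (proof_line_f tau @@ [:: shift_tm t; $0]).

Definition Con (tau : fm) : fm := Not (Pr tau (numeral (code Bot))).

(** ** Definability *)

(* The sentence whose code is D(code A, n). *)
Definition D_fm (A : fm) (n : nat) : fm := All (Iff (diag A) (Eq $0 (numeral n))).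

(* (n, y): y is the code of the numeral of n *)
Definition num_f : fm := lfp 2 (ors [::
  (let n := $0 in let y := $1 in
    And (Eq n Zero) (Eq y cZero));
  exs 2 (let m := $0 in let z := $1 in let n := $2 in let y := $3 in
    ands [:: rec 2 2 [:: m; z]; Eq n (Succ m); Eq y (cSucc z)])]).

(* (k, n, w): w = D(k, n) *)
Definition D_f : fm :=
  exs 2 (let f := $0 in let m := $1 in
         let k := $2 in let n := $3 in let w := $4 in
    let e := cEq (cVar Zero) m in
    ands [:: diag_f k f; num_f @@ [:: n; m];
             Eq w (cAll (cAnd (cImp f e) (cImp e f)))]).

(* Pr_T(D(k, n)) *)
Definition PrD (tau : fm) (k n : tm) : fm :=
  Ex (And (D_f @@ [:: shift_tm k; shift_tm n; $0]) (Pr tau $0)).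

Definition Def (tau : fm) (z y : tm) : fm :=
  Ex (And (len_lt $0 (shift_tm z)) (PrD tau $0 (shift_tm y))).

Definition Berry (tau : fm) (v u : tm) : fm :=
  And (Not (Def tau v u)) (ball u (Def tau (shift_tm v) $0)).

(* The length of Berry^{<x'}(x) as it occurs in Boolos(x), that is, in the
   scope of the quantifier that binds x': there x' is [$0] and x is [$1]. *)
Definition ell (tau : fm) : nat := len_fm (Berry tau $0 $1).

Definition bound (tau : fm) : tm := Mul (numeral 5) (numeral (ell tau)).

Definition Boolos (tau : fm) (x : tm) : fm :=
  Ex (And (Eq $0 (bound tau)) (Berry tau $0 (shift_tm x))).

(* Main.v *)
From Stdlib Require Import Classical ClassicalEpsilon FunctionalExtensionality.
From Stdlib Require Import PropExtensionality ProofIrrelevance.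
From mathcomp Require Import all_boot zify.
Require Import Defs.

(** Let N = 5 * ell.  In a model of T + Con(T) only finitely many standard codes
    have length < N, because Q bounds, by induction on a standard length, the
    codes of that length; each of them defines at most one standard number, by
    the uniqueness hypothesis.  So T cannot prove every Def^{<N}(n); let b be the
    least n for which it does not.  If T refuted Def^{<N}(b), then Boolos would
    provably hold of b only, and being shorter than N it would define b, so that T
    would prove Def^{<N}(b) by Sigma_1-completeness.  For this b, Boolos(b) is
    T-equivalent to the negation of Def^{<N}(b).

    Provability in T is replaced throughout by truth in all models of T
    (completeness theorem), so that reasoning inside Q becomes reasoning about
    an arbitrary structure satisfying the seven axioms. *)

Set Implicit Arguments.
Unset Strict Implicit.
Unset Printing Implicit Defensive.

(** * Substitution *)

(** A witness [x] of [Def] in a model may a priori be nonstandard, while the uniqueness hypothesis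
    speaks of numerals only. What must be shown inside arbitrary models is therefore that every
    element satisfying [len(x) < N] is standard and lies in a fixed finite list. Apart from this
    bound, each arithmetized notion is verified in one direction: it holds in the standard model
    where it should, and such truths pass up to all models of Q. What the provability formula says
    of nonstandard elements is never analysed.

    N is written as a product because the numeral of 5 * ell would itself take 15 * ell + 1 symbols.
    With the product, [Boolos] has length 4 * ell + 27: the numeral of ell accounts for 3 * ell,
    [Berry] for ell, and the rest is constant. Hence a coefficient above 4, and the need for ell to
    exceed 27. *)

Lemma subst_tm_comp s s' t :
  subst_tm s (subst_tm s' t) = subst_tm (fun i => subst_tm s (s' i)) t.
Proof. by elim: t => //= [t -> | t -> u -> | t -> u ->]. Qed.

Lemma subst_tm_id t : subst_tm Var t = t.
Proof. by elim: t => //= [t -> | t -> u -> | t -> u ->]. Qed.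

Lemma up_comp s s' :
  (fun i => subst_tm (up s) (up s' i)) = up (fun i => subst_tm s (s' i)).
Proof.
by apply: functional_extensionality => -[|i] //=; rewrite /shift_tm !subst_tm_comp.
Qed.

Lemma up_id : up Var = Var.
Proof. by apply: functional_extensionality => -[|i]. Qed.

Lemma subst_fm_comp s s' A :
  subst_fm s (subst_fm s' A) = subst_fm (fun i => subst_tm s (s' i)) A.
Proof.
by elim: A s s' => //= [t u|A IHA B IHB|A IHA B IHB|A IHA B IHB|A IHA|A IHA] s s';
  rewrite ?subst_tm_comp ?IHA ?IHB ?up_comp.
Qed.

Lemma subst_fm_id A : subst_fm Var A = A.
Proof.
by elim: A => //= [t u|A -> B ->|A -> B ->|A -> B ->|A IHA|A IHA];
  rewrite ?subst_tm_id ?up_id ?IHA.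
Qed.

Lemma inst_up t s A :
  inst t (subst_fm (up s) A) = subst_fm (scons t s) A.
Proof.
rewrite /inst subst_fm_comp; congr subst_fm.
apply: functional_extensionality => -[|i] //=.
by rewrite /shift_tm subst_tm_comp -[RHS]subst_tm_id.
Qed.

Lemma inst_shift_tm t u : subst_tm (scons t Var) (shift_tm u) = u.
Proof. by rewrite /shift_tm subst_tm_comp -[RHS]subst_tm_id. Qed.

Lemma tm_below_leq m n t : m <= n -> tm_below m t -> tm_below n t.
Proof.
move=> mn; elim: t => //= [i|t IHt u IHu|t IHt u IHu]; first by move=> im; apply: leq_trans mn.
- by case/andP=> /IHt -> /IHu.
- by case/andP=> /IHt -> /IHu.
Qed.

Lemma fm_below_leq m n A : m <= n -> fm_below m A -> fm_below n A.
Proof.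
elim: A m n => //= [t u|A IHA B IHB|A IHA B IHB|A IHA B IHB|A IHA|A IHA] m n mn;
  try by case/andP=> /(IHA _ _ mn) -> /(IHB _ _ mn).
- by case/andP=> /(tm_below_leq mn) -> /(tm_below_leq mn).
- exact: IHA.
- exact: IHA.
Qed.

Lemma tm_below_ex t : exists n, tm_below n t.
Proof.
elim: t => [i||t [n]|t [m Ht] u [n Hu]|t [m Ht] u [n Hu]] /=;
  [by exists i.+1 | by exists 0 | by exists n | |];
  by exists (maxn m n); rewrite (tm_below_leq (leq_maxl _ _) Ht)
     (tm_below_leq (leq_maxr _ _) Hu).
Qed.

Lemma fm_below_ex A : exists n, fm_below n A.
Proof.
elim: A => [|t u|A [m HA] B [n HB]|A [m HA] B [n HB]|A [m HA] B [n HB]|A [n HA]|A [n HA]] /=;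
  try by exists (maxn m n); rewrite (fm_below_leq (leq_maxl _ _) HA)
     (fm_below_leq (leq_maxr _ _) HB).
- by exists 0.
- have [m Ht] := tm_below_ex t; have [n Hu] := tm_below_ex u.
  by exists (maxn m n); rewrite (tm_below_leq (leq_maxl _ _) Ht)
     (tm_below_leq (leq_maxr _ _) Hu).
- by exists n; apply: fm_below_leq HA.
- by exists n; apply: fm_below_leq HA.
Qed.

Lemma subst_tm_below n s s' t :
  tm_below n t -> (forall i, i < n -> s i = s' i) -> subst_tm s t = subst_tm s' t.
Proof.
move=> + H; elim: t => //= [t IH /IH -> //|t IHt u IHu|t IHt u IHu];
  by case/andP=> /IHt -> /IHu ->.
Qed.

Lemma subst_fm_below n s s' A :
  fm_below n A -> (forall i, i < n -> s i = s' i) -> subst_fm s A = subst_fm s' A.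
Proof.
have upE k (f g : nat -> tm) : (forall i, i < k -> f i = g i) ->
  forall i, i < k.+1 -> up f i = up g i by move=> H [|i] //= ik; rewrite H.
elim: A n s s' => //= [t u|A IHA B IHB|A IHA B IHB|A IHA B IHB|A IHA|A IHA] n s s';
  try by case/andP=> bA bB H; rewrite (IHA _ _ _ bA H) (IHB _ _ _ bB H).
- by case/andP=> bt bu H; rewrite (subst_tm_below bt H) (subst_tm_below bu H).
- by move=> bA H; rewrite (IHA _ _ _ bA (upE _ _ _ H)).
- by move=> bA H; rewrite (IHA _ _ _ bA (upE _ _ _ H)).
Qed.

Lemma prv_subst T s A : prv T A -> prv T (subst_fm s A).
Proof.
have [n bA] := fm_below_ex A.
(* The calculus has no substitution rule. [sn n s] is the effect of n generalizations of index 0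
   followed by n instantiations: the first n variables become [s i], the others drop by n. *)
pose sn n s i := if i < n then s i else Var (i - n) : tm.
suff gen m : forall B s, prv T B -> prv T (subst_fm (sn m s) B).
  move=> /(gen n _ s); congr prv; apply: subst_fm_below bA _ => i.
  by rewrite /sn => ->.
elim: m => [|m IH] B r pB.
  rewrite (_ : sn 0 r = Var) ?subst_fm_id //.
  by apply: functional_extensionality => i; rewrite /sn subn0.
have := IH _ (fun i => r i.+1) (pGen pB) => /= pAll.
have := pMP (pLog _ (lAllE _ (r 0))) pAll; rewrite inst_up.
by congr prv; congr subst_fm; apply: functional_extensionality => -[].
Qed.

(** * Derivations from hypotheses *)

(** Generalization is confined to the theorems [prv T], so the deduction theorem [der_intro] needs
    no eigenvariable condition. Generalization under hypotheses comes back as [der_gen]. *)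
Inductive der (T : theory) (G : fm -> Prop) : fm -> Prop :=
| dThm A : prv T A -> der T G A
| dHyp A : G A -> der T G A
| dMP A B : der T G (Imp A B) -> der T G A -> der T G B.

Definition hyps (H : seq fm) : fm -> Prop := fun A => List.In A H.

Lemma der_log T G A : logax A -> der T G A.
Proof. by move=> l; apply: dThm; apply: pLog. Qed.

Lemma der_sub T (G G' : fm -> Prop) A :
  (forall B, G B -> G' B) -> der T G A -> der T G' A.
Proof.
move=> sGG'; elim=> {A} [A|A /sGG'|A B _ IHAB _ IHA]; [exact: dThm | exact: dHyp |].
exact: dMP IHAB IHA.
Qed.

Lemma prv_id T A : prv T (Imp A A).
Proof.
exact: pMP (pMP (pLog _ (lS A (Imp A A) A)) (pLog _ (lK _ _))) (pLog _ (lK _ _)).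
Qed.

Lemma der_intro T H A B : der T (hyps (A :: H)) B -> der T (hyps H) (Imp A B).
Proof.
elim=> {B} [B pB|B [-> | HB]|B C _ IHBC _ IHB].
- by apply: dThm; apply: pMP pB; apply: pLog; apply: lK.
- exact: dThm (prv_id _ _).
- by apply: dMP (dHyp _ HB); apply: der_log; apply: lK.
- by apply: dMP IHB; apply: dMP IHBC; apply: der_log; apply: lS.
Qed.

Lemma der_hyp T H A : der T (hyps (A :: H)) A.
Proof. by apply: dHyp; left. Qed.

Lemma der_weak T H A B : der T (hyps H) B -> der T (hyps (A :: H)) B.
Proof. by apply: der_sub => C; right. Qed.

Lemma der_nil T A : der T (hyps [::]) A -> prv T A.
Proof. by elim=> {A} // A B _ pAB _ pA; apply: pMP pAB pA. Qed.

Lemma der_dn T G A : der T G (Not (Not A)) -> der T G A.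
Proof. by apply: dMP; apply: der_log; apply: lDN. Qed.

Lemma der_bot T G A : der T G Bot -> der T G A.
Proof.
by move=> dB; apply: der_dn; apply: dMP dB; apply: der_log; apply: lK.
Qed.

Lemma der_contra T H A : der T (hyps (Not A :: H)) Bot -> der T (hyps H) A.
Proof. by move/der_intro/der_dn. Qed.

Lemma der_imp_trans T H A B C :
  der T (hyps H) (Imp A B) -> der T (hyps H) (Imp B C) -> der T (hyps H) (Imp A C).
Proof.
by move=> /(der_weak A) dAB /(der_weak A) dBC; apply/der_intro/(dMP dBC)/(dMP dAB)/der_hyp.
Qed.

Lemma der_imps T H A : der T (hyps H) A -> prv T (foldr Imp A (rev H)).
Proof.
elim: H A => [|B H IH] A; first exact: der_nil.
by move/der_intro/IH; rewrite rev_cons foldr_rcons.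
Qed.

Lemma imps_der T H A : prv T (foldr Imp A (rev H)) -> der T (hyps H) A.
Proof.
elim: H A => [|B H IH] A; first exact: dThm.
rewrite rev_cons foldr_rcons => /IH /(der_weak B) dA.
exact: dMP dA (der_hyp _ _ _).
Qed.

Lemma all_imps T H A :
  prv T (Imp (All (foldr Imp A (map shift_fm H))) (foldr Imp (All A) H)).
Proof.
elim: H => [|B H IH] /=; first exact: prv_id.
apply: der_nil; apply: (der_imp_trans (B := Imp B (All (foldr Imp A (map shift_fm H))))).
  by apply: der_log; apply: lAllI.
do 2 apply: der_intro; apply: dMP (dThm _ IH) _.
by apply: (dMP (A := B)); apply: dHyp; [right; left | left].
Qed.

Lemma subst_imps s H A :
  subst_fm s (foldr Imp A H) = foldr Imp (subst_fm s A) (map (subst_fm s) H).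
Proof. by elim: H => //= B H ->. Qed.

Lemma der_gen T H A n :
  (forall B, List.In B H -> fm_below n B) -> fm_below n.+1 A ->
  der T (hyps H) (inst (Var n) A) -> der T (hyps H) (All A).
Proof.
move=> bH bA /der_imps dA; apply: imps_der; apply: pMP (all_imps _ _ _) _.
(* [Var n] is fresh for [H] and for [All A]; [s] moves it to index 0 and raises the smaller
   variables, so that generalizing the substituted theorem binds exactly this variable. *)
pose s i := if i == n then Var 0 else Var i.+1.
have sE i : i < n -> s i = Var i.+1 by rewrite /s; case: ltngtP.
have -> : foldr Imp A (map shift_fm (rev H))
          = subst_fm s (foldr Imp (inst (Var n) A) (rev H)).
  rewrite subst_imps; congr (foldr _ _ _).
    rewrite /inst subst_fm_comp -[LHS]subst_fm_id; apply: subst_fm_below bA _.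
    move=> [|i] /=; first by rewrite /s eqxx.
    by rewrite ltnS => /sE.
  rewrite !map_rev; congr rev; apply: List.map_ext_in => B /bH bB.
  by apply/esym/(subst_fm_below bB) => i /sE.
exact: pGen (prv_subst _ dA).
Qed.

(** * Completeness *)

Record structure := Structure {
  car :> Type;
  s0 : car;
  sS : car -> car;
  sadd : car -> car -> car;
  smul : car -> car -> car }.

Fixpoint meval (M : structure) (r : nat -> M) (t : tm) : M :=
  match t with
  | Var i => r i
  | Zero => s0 M
  | Succ t => sS (meval r t)
  | Add t u => sadd (meval r t) (meval r u)
  | Mul t u => smul (meval r t) (meval r u)
  end.

Fixpoint msat (M : structure) (r : nat -> M) (A : fm) : Prop :=
  match A with
  | Bot => False
  | Eq t u => meval r t = meval r u
  | Imp A B => msat r A -> msat r B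
  | And A B => msat r A /\ msat r B
  | Or A B => msat r A \/ msat r B
  | All A => forall n, msat (scons n r) A
  | Ex A => exists n, msat (scons n r) A
  end.

Definition model (M : structure) (T : theory) : Prop :=
  forall A, T A -> forall r : nat -> M, msat r A.

Lemma meval_subst (M : structure) (r : nat -> M) s t :
  meval r (subst_tm s t) = meval (fun i => meval r (s i)) t.
Proof. by elim: t => //= [t -> | t -> u -> | t -> u ->]. Qed.

Lemma meval_shift (M : structure) (r : nat -> M) n t :
  meval (scons n r) (shift_tm t) = meval r t.
Proof. by rewrite /shift_tm meval_subst. Qed.

Lemma scons_up (M : structure) (r : nat -> M) n s :
  (fun i => meval (scons n r) (up s i)) = scons n (fun i => meval r (s i)).
Proof. by apply: functional_extensionality => -[|i] //=; rewrite meval_shift. Qed.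

Lemma msat_subst (M : structure) (r : nat -> M) s A :
  msat r (subst_fm s A) = msat (fun i => meval r (s i)) A.
Proof.
elim: A r s => //= [t u|A IHA B IHB|A IHA B IHB|A IHA B IHB|A IHA|A IHA] r s;
  rewrite ?meval_subst ?IHA ?IHB //.
- apply: propositional_extensionality; split=> H n;
    by have := H n; rewrite IHA scons_up.
- congr ex; apply: functional_extensionality => n.
  by rewrite IHA scons_up.
Qed.

Lemma msat_inst (M : structure) (r : nat -> M) t A :
  msat r (inst t A) = msat (scons (meval r t) r) A.
Proof.
by rewrite /inst msat_subst; congr msat; apply: functional_extensionality => -[].
Qed.

Lemma msat_shift (M : structure) (r : nat -> M) n A :
  msat (scons n r) (shift_fm A) = msat r A.
Proof. by rewrite /shift_fm msat_subst. Qed.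

Lemma soundness (M : structure) T A :
  model M T -> prv T A -> forall r : nat -> M, msat r A.
Proof.
move=> MT; elim=> {A} [A /MT //|A lA r|A B _ IHAB _ IHA r|A _ IHA r n] /=;
  [|exact: IHAB (IHA _) | exact: IHA].
case: lA => {A} /=; try tauto.
- by move=> A nnA; apply: NNPP.
- by move=> A t; rewrite msat_inst; apply.
- by move=> A B H a n; apply: H; rewrite msat_shift.
- by move=> A t; rewrite msat_inst; exists (meval r t).
- by move=> A B H [n /H]; rewrite msat_shift.
- by move=> A t u tu; rewrite !msat_inst tu.
Qed.

(** The value lies between the consecutive squares of [m + n] and [m + n + 1], so it determines the
    sum, and then the first component. *)
Lemma npair_inj m n m' n' : npair m n = npair m' n' -> m = m' /\ n = n'.
Proof.
have lt_sq a b c d : a + b < c + d -> npair a b < npair c d.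
  by move=> lt; have := leq_mul lt lt; rewrite /npair; nia.
move=> E; have [/lt_sq|/lt_sq|] := ltngtP (m + n) (m' + n'); rewrite ?E ?ltnn //.
by move: E; rewrite /npair => + Es; rewrite Es; lia.
Qed.

Lemma code_tm_inj t u : code_tm t = code_tm u -> t = u.
Proof.
elim: t u => [i||t IH|t IHt v IHv|t IHt v IHv] [j||t'|t' v'|t' v'] //= /npair_inj [] //.
- by move=> _ ->.
- by move=> _ /IH ->.
- by move=> _ /npair_inj [/IHt -> /IHv ->].
- by move=> _ /npair_inj [/IHt -> /IHv ->].
Qed.

Lemma code_inj A B : code A = code B -> A = B.
Proof.
elim: A B => [|t u|A IHA B IHB|A IHA B IHB|A IHA B IHB|A IHA|A IHA]
  [|t' u'|A' B'|A' B'|A' B'|A'|A'] //= /npair_inj [] //;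
  try by move=> _ /npair_inj [/IHA -> /IHB ->].
- by move=> _ /npair_inj [/code_tm_inj -> /code_tm_inj ->].
- by move=> _ /IHA ->.
- by move=> _ /IHA ->.
Qed.

Definition con (T : theory) (H : seq fm) : Prop := ~ der T (hyps H) Bot.

Lemma con_extend T H A : con T H -> con T (A :: H) \/ con T (Not A :: H).
Proof.
move=> cH; apply: NNPP => /not_or_and [/NNPP /der_intro dN /NNPP /der_intro dNN].
exact: cH (dMP dNN dN).
Qed.

Lemma hyps_below H : exists n, forall A, List.In A H -> fm_below n A.
Proof.
elim: H => [|B H [n bH]]; first by exists 0.
have [m bB] := fm_below_ex B; exists (maxn m n) => A [<-|/bH].
  exact: fm_below_leq (leq_maxl _ _) bB.
exact: fm_below_leq (leq_maxr _ _).
Qed.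

(** A variable outside the finite list is a witness: refuting its instance would derive [All B] by
    [der_gen]. Freshness for [T] is no issue, since theorems are closed under substitution. *)
Lemma con_witness T H B : con T (Not (All B) :: H) ->
  exists t, con T (Not (inst t B) :: Not (All B) :: H).
Proof.
move=> cH; have [n bH] := hyps_below (Not (All B) :: H).
exists (Var n) => /der_contra dB; apply: cH; apply: dMP (der_hyp _ _ _) _.
by have /= := bH _ (or_introl erefl); rewrite andbT => bB; apply: der_gen bH bB dB.
Qed.

Definition decides (H : seq fm) (A : fm) : Prop :=
  List.In A H \/ List.In (Not A) H /\
    (forall B, A = All B -> exists t, List.In (Not (inst t B)) H).

(** Stage n treats the formula of code n, if there is one. By [code_inj] it is unique, so each
    formula is decided at the stage given by its own code. *)
Lemma con_step T H n : con T H ->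
  exists H', [/\ con T H', forall A, List.In A H -> List.In A H'
               & forall A, code A = n -> decides H' A].
Proof.
move=> cH; have [[A cA]|noA] := classic (exists A, code A = n); last first.
  by exists H; split=> // A cA; case: noA; exists A.
have AE B : code B = n -> B = A by rewrite -cA; apply: code_inj.
have [cAH|cNH] := con_extend A cH.
  exists (A :: H); split=> // B; first by right.
  by move/AE->; left; left.
have [[B AB]|nAll] := classic (exists B, A = All B); last first.
  exists (Not A :: H); split=> // B; first by right.
  by move/AE->; right; split; [left | move=> C AC; case: nAll; exists C].
have [t ct] : exists t, con T (Not (inst t B) :: Not A :: H).
  by rewrite AB in cNH *; apply: con_witness.
exists (Not (inst t B) :: Not A :: H); split=> // C; first by do 2 right.
move/AE->; right; split; first by right; left.
by rewrite AB => D [<-]; exists t; left.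
Qed.

(* A maximal consistent set with Henkin witnesses: the free variables serve as
   the witnessing constants. *)
Lemma henkin_set T H0 : con T H0 -> exists G : fm -> Prop,
  [/\ forall A, prv T A -> G A,
      forall A, List.In A H0 -> G A,
      forall A B, G (Imp A B) -> G A -> G B,
      ~ G Bot
    & forall A, G A \/ G (Not A) /\
        (forall B, A = All B -> exists t, G (Not (inst t B)))].
Proof.
move=> cH0; pose ctx := {H | con T H}.
pose next (n : nat) (H : ctx) : ctx :=
  let: exist H' P := constructive_indefinite_description _ (con_step n (svalP H)) in
  exist _ H' (let: And3 c _ _ := P in c).
have nextP n (H : ctx) : (forall A, List.In A (sval H) -> List.In A (sval (next n H)))
    /\ (forall A, code A = n -> decides (sval (next n H)) A).
  by rewrite /next; case: constructive_indefinite_description => H' [].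
pose chain := fix chain n : ctx := if n is m.+1 then next m (chain m) else exist _ H0 cH0.
pose h n := hyps (sval (chain n)).
have h_mono m n A : m <= n -> h m A -> h n A.
  move=> /subnK <-; elim: (n - m) => // k IH /IH; rewrite addSn.
  exact: (nextP _ _).1.
(* The set is the deductive closure of the union of the chain; a derivation of [Bot] would already
   live at a single stage, which is consistent. *)
exists (fun A => exists n, der T (h n) A); split.
- by move=> A pA; exists 0; apply: dThm.
- by move=> A HA; exists 0; apply: dHyp.
- move=> A B [m dAB] [n dA]; exists (maxn m n).
  by apply: (dMP (A := A)); [apply: der_sub dAB | apply: der_sub dA] => C;
    apply: h_mono; rewrite ?leq_maxl ?leq_maxr.
- by move=> [n]; apply: (svalP (chain n)).
- move=> A; case: ((nextP (code A) (chain (code A))).2 A erefl) => [HA|[HA w]].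
    by left; exists (code A).+1; apply: dHyp.
  right; split; first by exists (code A).+1; apply: dHyp.
  by move=> B /w [t Ht]; exists t, (code A).+1; apply: dHyp.
Qed.

Section TermModel.

Variables (T : theory) (G : fm -> Prop).
Hypothesis G_thm : forall A, prv T A -> G A.
Hypothesis G_mp : forall A B, G (Imp A B) -> G A -> G B.
Hypothesis G_bot : ~ G Bot.
Hypothesis G_dec : forall A, G A \/ G (Not A) /\
  (forall B, A = All B -> exists t, G (Not (inst t B))).

Let G_log A : logax A -> G A. Proof. by move=> l; apply/G_thm/pLog. Qed.

Let G_not A : G (Not A) <-> ~ G A.
Proof.
split=> [nA /(G_mp nA) //|nA]; by case: (G_dec A) => [//|[]].
Qed.

Let G_imp A B : G (Imp A B) <-> (G A -> G B).
Proof.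
split=> [/G_mp //|AB]; have [/AB GB|/G_not nA] := classic (G A).
  by apply: G_mp GB; apply/G_log/lK.
apply: G_mp nA; apply: G_thm; apply: der_nil; do 2 apply: der_intro.
by apply: der_bot; apply: (dMP (A := A)); apply: dHyp; [right; left | left].
Qed.

Let G_and A B : G (And A B) <-> G A /\ G B.
Proof.
split=> [AB|[GA GB]]; last by apply: G_mp GB; apply: G_mp GA; apply/G_log/lAndI.
by split; apply: G_mp AB; apply: G_log; [apply: lAndEl | apply: lAndEr].
Qed.

Let G_or A B : G (Or A B) <-> G A \/ G B.
Proof.
split=> [AB|[GA|GB]]; last 2 first.
- by apply: G_mp GA; apply/G_log/lOrIl.
- by apply: G_mp GB; apply/G_log/lOrIr.
apply: NNPP => /not_or_and [/G_not nA /G_not nB]; apply: G_bot.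
exact: G_mp (G_mp (G_mp (G_log (lOrE A B Bot)) nA) nB) AB.
Qed.

Let G_all A : G (All A) <-> forall t, G (inst t A).
Proof.
split=> [GA t|GA]; first by apply: G_mp GA; apply/G_log/lAllE.
by case: (G_dec (All A)) => // -[_ /(_ A erefl) [t /G_not]]; case.
Qed.

Let G_ex A : G (Ex A) <-> exists t, G (inst t A).
Proof.
split=> [GA|[t]]; last by apply: G_mp; apply/G_log/lExI.
apply: NNPP => nex; apply: G_bot; apply: G_mp GA; apply: G_mp.
  exact: (G_log (lExE A Bot)).
by apply/G_all => t; apply/G_imp => GA; case: nex; exists t.
Qed.

Definition teq t u := G (Eq t u).

Let teq_refl t : teq t t. Proof. exact/G_log/lEqR. Qed.

Let teq_subst A t u : teq t u -> G (inst t A) -> G (inst u A).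
Proof. by move=> tu; apply: G_mp; apply: G_mp tu; apply/G_log/lEqL. Qed.

Let teq_sym t u : teq t u -> teq u t.
Proof.
move=> tu; have := teq_subst (A := Eq $0 (shift_tm t)) tu.
by rewrite /inst /= !inst_shift_tm; apply; apply: teq_refl.
Qed.

Let teq_trans t u v : teq t u -> teq u v -> teq t v.
Proof.
move=> tu uv; have := teq_subst (A := Eq (shift_tm t) $0) uv.
by rewrite /inst /= !inst_shift_tm; apply.
Qed.

(** Leibniz's axiom for the formula [f[t] = f], with [f[t]] protected by a shift, turns reflexivity
    of [f[t]] into congruence. *)
Let teq_congr f t u : teq t u ->
  teq (subst_tm (scons t Var) f) (subst_tm (scons u Var) f).
Proof.
move=> tu; have := teq_subst (A := Eq (shift_tm (subst_tm (scons t Var) f)) f) tu.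
by rewrite /inst /= !inst_shift_tm; apply; apply: teq_refl.
Qed.

(** [msat] reads [Eq] as identity of the carrier, so terms must be taken modulo provable equality. A
    class is its membership predicate, which lets extensionality identify the classes of equal
    terms. *)
Definition tclass := {P : tm -> Prop | exists t, P = teq t}.

Definition cls t : tclass := exist _ (teq t) (ex_intro _ t erefl).

Definition repr (c : tclass) : tm :=
  sval (constructive_indefinite_description _ (svalP c)).

Let clsP t u : cls t = cls u <-> teq t u.
Proof.
split=> [[E]|tu]; first by rewrite /teq -/(teq t u) E; apply: teq_refl.
apply: eq_sig_hprop => [P|] /=; first exact: proof_irrelevance.
apply: functional_extensionality => v; apply: propositional_extensionality.
by split; apply: teq_trans => //; apply: teq_sym.
Qed.

Let reprK c : cls (repr c) = c.
Proof.
apply: eq_sig_hprop => [P|] /=; first exact: proof_irrelevance.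
by rewrite /repr; case: constructive_indefinite_description.
Qed.

Definition term_model : structure :=
  Structure (cls Zero) (fun c => cls (Succ (repr c)))
    (fun c d => cls (Add (repr c) (repr d))) (fun c d => cls (Mul (repr c) (repr d))).

Let repr_cls t : teq (repr (cls t)) t.
Proof. by apply/clsP; rewrite reprK. Qed.

Let meval_cls s t : @meval term_model (fun i => cls (s i)) t = cls (subst_tm s t).
Proof.
have bin (f : tm -> tm -> tm) t1 u1 t2 u2 :
    (forall x y v, subst_tm (scons v Var) (f x y) =
       f (subst_tm (scons v Var) x) (subst_tm (scons v Var) y)) ->
    teq t1 t2 -> teq u1 u2 -> teq (f t1 u1) (f t2 u2).
  move=> fE tt uu; apply: (teq_trans (u := f t2 u1)).
    by have := teq_congr (f $0 (shift_tm u1)) tt; rewrite !fE !inst_shift_tm.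
  by have := teq_congr (f (shift_tm t2) $0) uu; rewrite !fE !inst_shift_tm.
elim: t => //= [t ->|t -> u ->|t -> u ->]; apply/clsP.
- exact: (teq_congr (Succ $0)) (repr_cls _).
- by apply: bin.
- by apply: bin.
Qed.

(** Every element is the class of a term, so a quantifier over the model amounts to extending the
    substitution [s]; this is why the truth lemma is proved for all [s] at once. *)
Lemma term_model_sat s A : @msat term_model (fun i => cls (s i)) A <-> G (subst_fm s A).
Proof.
have sconsE t r : scons (cls t) (fun i => cls (r i)) = (fun i => cls (scons t r i)).
  by apply: functional_extensionality => -[].
elim: A s => /= [|t u|A IHA B IHB|A IHA B IHB|A IHA B IHB|A IHA|A IHA] s.
- by split.
- by rewrite !meval_cls clsP.
- by rewrite G_imp IHA IHB.
- by rewrite G_and IHA IHB.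
- by rewrite G_or IHA IHB.
- rewrite G_all; split=> H t.
    by rewrite inst_up -IHA -sconsE; apply: H.
  by rewrite -[t]reprK sconsE IHA -inst_up.
- rewrite G_ex; split=> -[t H].
    by exists (repr t); rewrite inst_up -IHA -sconsE reprK.
  by exists (cls t); rewrite sconsE IHA -inst_up.
Qed.

Lemma term_model_model : model term_model T.
Proof.
move=> A TA r; have -> : r = fun i => cls (repr (r i)).
  by apply: functional_extensionality => i; rewrite reprK.
by apply/term_model_sat/G_thm/prv_subst/pAx.
Qed.

End TermModel.

Lemma con_model T H : con T H -> exists (M : structure) (r : nat -> M),
  model M T /\ forall A, List.In A H -> msat r A.
Proof.
move=> /henkin_set [G [thm hypG mp bot dec]].
exists (term_model G), (fun i => cls G (Var i)).
split=> [|A HA]; first exact: term_model_model.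
by apply/(term_model_sat thm mp bot dec); rewrite subst_fm_id; apply: hypG.
Qed.

Theorem completeness T A :
  (forall M : structure, model M T -> forall r : nat -> M, msat r A) -> prv T A.
Proof.
move=> vA; apply: der_nil; apply: der_contra; apply: NNPP => /con_model.
by move=> [M [r [/vA MA /(_ (Not A))]]] /= []; [left | apply: MA].
Qed.

Lemma consistent_model T : consistent T -> exists M : structure, model M T.
Proof.
move=> cT; have [|M [r [MT _]]] := @con_model T [::]; last by exists M.
by move/der_nil.
Qed.

(** * Models of Robinson arithmetic *)

Definition natM : structure := Structure 0 S addn muln.

Lemma eval_natM r t : eval r t = @meval natM r t.
Proof. by elim: t => //= [t -> | t -> u -> | t -> u ->]. Qed.

Lemma sat_natM r A : sat r A <-> @msat natM r A.
Proof.
elim: A r => //= [t u|A IHA B IHB|A IHA B IHB|A IHA B IHB|A IHA|A IHA] r;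
  rewrite ?IHA ?IHB ?eval_natM //.
- by split=> H n; apply/IHA.
- by split=> -[n H]; exists n; apply/IHA.
Qed.

Definition mnum (M : structure) (n : nat) : M := iter n (@sS M) (s0 M).
Definition mlt (M : structure) (x y : M) : Prop := exists z, sadd z (sS x) = y.
Definition mpair (M : structure) (x y : M) : M :=
  sadd (smul (sadd x y) (sadd x y)) x.

Lemma mnum_nat n : mnum natM n = n.
Proof. by elim: n => //= n ->. Qed.

Lemma mlt_nat m n : @mlt natM m n <-> m < n.
Proof.
split=> [[z <-]|lt_mn]; first by rewrite /=; lia.
by exists (n - m.+1) => /=; lia.
Qed.

Lemma meval_numeral (M : structure) (r : nat -> M) n : meval r (numeral n) = mnum M n.
Proof. by elim: n => //= n ->. Qed.

Section QModel.

Variables (M : structure) (MQ : model M Q).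

Let r0 : nat -> M := fun _ => s0 M.

Lemma mS_neq0 (x : M) : sS x <> s0 M.
Proof. exact: (MQ Q1 r0 x). Qed.

Lemma mS_inj (x y : M) : sS x = sS y -> x = y.
Proof. exact: (MQ Q2 r0 y x). Qed.

Lemma m_case (x : M) : x = s0 M \/ exists y, x = sS y.
Proof.
by have [->|/(MQ Q3 r0 x)] := classic (x = s0 M); [left | right].
Qed.

Lemma maddn0 (x : M) : sadd x (s0 M) = x.
Proof. exact: (MQ Q4 r0 x). Qed.

Lemma maddnS (x y : M) : sadd x (sS y) = sS (sadd x y).
Proof. exact: (MQ Q5 r0 y x). Qed.

Lemma mmuln0 (x : M) : smul x (s0 M) = s0 M.
Proof. exact: (MQ Q6 r0 x). Qed.

Lemma mmulnS (x y : M) : smul x (sS y) = sadd (smul x y) x.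
Proof. exact: (MQ Q7 r0 y x). Qed.

Lemma mnum_inj m n : mnum M m = mnum M n -> m = n.
Proof.
elim: m n => [|m IH] [|n] //=; first by move/esym/mS_neq0.
  by move/mS_neq0.
by move/mS_inj/IH->.
Qed.

Lemma mnum_add m n : sadd (mnum M m) (mnum M n) = mnum M (m + n).
Proof. by elim: n => [|n IH]; rewrite ?addn0 ?maddn0 // addnS /= maddnS IH. Qed.

Lemma mnum_mul m n : smul (mnum M m) (mnum M n) = mnum M (m * n).
Proof.
by elim: n => [|n IH]; rewrite ?muln0 ?mmuln0 //= mmulnS IH mnum_add mulnSr.
Qed.

Lemma mnum_pair m n : mpair (mnum M m) (mnum M n) = mnum M (npair m n).
Proof. by rewrite /mpair !(mnum_add, mnum_mul). Qed.

(** The model has no induction; instead successors are peeled off the second summand, at most n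
    times, by induction on the standard number n. This is what forces parts of a standard sum to be
    standard. *)
Lemma madd_eq_num (x y : M) n : sadd x y = mnum M n ->
  exists i j, [/\ x = mnum M i, y = mnum M j & i + j = n].
Proof.
elim: n y => [|n IH] y; have [->|[y' ->]] := m_case y; rewrite ?maddn0 ?maddnS.
- by move=> ->; exists 0, 0.
- by move/mS_neq0.
- by move=> ->; exists n.+1, 0; rewrite addn0.
- by move/mS_inj/IH => [i [j [-> -> <-]]]; exists i, j.+1; rewrite addnS.
Qed.

Lemma mlt_num (x : M) n : mlt x (mnum M n) <-> exists2 k, k < n & x = mnum M k.
Proof.
split=> [[z]|[k lt_kn ->]].
  rewrite maddnS; case: n => [/mS_neq0 //|n /mS_inj /madd_eq_num [i [j [_ -> <-]]]].
  by exists j => //; rewrite ltnS leq_addl.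
exists (mnum M (n - k.+1)); rewrite (mnum_add _ k.+1); congr mnum; lia.
Qed.

(** Two arbitrary elements of a model of Q need not be comparable. Comparison with a standard
    element succeeds by induction on n outside the model. *)
Lemma mlt_total (x : M) n : mlt x (mnum M n) \/ x = mnum M n \/ mlt (mnum M n) x.
Proof.
elim: n x => [|n IH] x; have [->|[y ->]] := m_case x.
- by right; left.
- by right; right; exists y; rewrite /= maddnS maddn0.
- by left; apply/mlt_num; exists 0.
case: (IH y) => [/mlt_num [k lt_kn ->]|[->|[z <-]]].
- by left; apply/mlt_num; exists k.+1.
- by right; left.
- by right; right; exists z; rewrite maddnS.
Qed.

End QModel.

Lemma natM_Q : model natM Q.
Proof.
move=> A []{A} r /=.
- by move=> n.
- by move=> m n [].
- by move=> [|n] // _; exists n.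
- exact: addn0.
- by move=> m n; rewrite addnS.
- exact: muln0.
- by move=> m n; rewrite mulnSr.
Qed.

Lemma mnum_scons (M : structure) n (r : nat -> nat) :
  (fun i => mnum M (scons n r i)) = scons (mnum M n) (fun i => mnum M (r i)).
Proof. by apply: functional_extensionality => -[]. Qed.

Lemma meval_mnum (M : structure) (MQ : model M Q) r t :
  meval (fun i => mnum M (r i)) t = mnum M (@meval natM r t).
Proof.
by elim: t => //= [t ->|t -> u ->|t -> u ->]; rewrite ?mnum_add ?mnum_mul.
Qed.

(** Truth in the standard model, compared with truth at standard arguments in an
    arbitrary model of Q.  Semantically defined, these classes are closed under
    substitution for free. *)

Definition absolute (A : fm) : Prop := forall M : structure, model M Q ->
  forall r : nat -> nat, @msat natM r A <-> msat (fun i => mnum M (r i)) A.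

Definition upward (A : fm) : Prop := forall M : structure, model M Q ->
  forall r : nat -> nat, @msat natM r A -> msat (fun i => mnum M (r i)) A.

Lemma absolute_upward A : absolute A -> upward A.
Proof. by move=> aA M MQ r /(aA M MQ). Qed.

Lemma absolute_Bot : absolute Bot. Proof. by []. Qed.

Lemma absolute_Eq t u : absolute (Eq t u).
Proof.
move=> M MQ r /=; rewrite !meval_mnum //; split=> [-> //|]; exact: mnum_inj.
Qed.

Lemma absolute_Imp A B : absolute A -> absolute B -> absolute (Imp A B).
Proof. by move=> aA aB M MQ r /=; rewrite (aA M MQ) (aB M MQ). Qed.

Lemma absolute_And A B : absolute A -> absolute B -> absolute (And A B).
Proof. by move=> aA aB M MQ r /=; rewrite (aA M MQ) (aB M MQ). Qed.

Lemma absolute_Or A B : absolute A -> absolute B -> absolute (Or A B).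
Proof. by move=> aA aB M MQ r /=; rewrite (aA M MQ) (aB M MQ). Qed.

Lemma msat_ltf (M : structure) (r : nat -> M) t u :
  msat r (ltf t u) <-> mlt (meval r t) (meval r u).
Proof.
have -> : msat r (ltf t u) = exists z, sadd z (sS (meval (scons z r) (shift_tm t)))
                                       = meval (scons z r) (shift_tm u) by [].
by split=> -[z H]; exists z; move: H; rewrite !meval_shift.
Qed.

Lemma msat_ball (M : structure) (r : nat -> M) t A :
  msat r (ball t A) <-> forall x, mlt x (meval r t) -> msat (scons x r) A.
Proof.
have -> : msat r (ball t A) = forall x, msat (scons x r) (ltf $0 (shift_tm t)) ->
                                        msat (scons x r) A by [].
by split=> H x; have := H x; rewrite msat_ltf meval_shift.
Qed.

Lemma msat_bex (M : structure) (r : nat -> M) t A :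
  msat r (bex t A) <-> exists2 x, mlt x (meval r t) & msat (scons x r) A.
Proof.
have -> : msat r (bex t A) = exists x, msat (scons x r) (ltf $0 (shift_tm t)) /\
                                       msat (scons x r) A by [].
split=> [[x []]|[x]]; last by move=> ? ?; exists x; rewrite msat_ltf meval_shift.
by rewrite msat_ltf meval_shift => ? ?; exists x.
Qed.

Lemma absolute_ltf t u : absolute (ltf t u).
Proof.
move=> M MQ r; rewrite !msat_ltf !meval_mnum // mlt_nat mlt_num //.
split=> [lt_tu|[k lt_k /(mnum_inj MQ) -> //]]; by exists (@meval natM r t).
Qed.

(** By [mlt_num] nothing nonstandard lies below a standard bound, so the quantifier ranges over the
    same elements in both structures. *)
Lemma absolute_ball t A : absolute A -> absolute (ball t A).
Proof.
move=> aA M MQ r; rewrite !msat_ball meval_mnum //.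
split=> [H x /(mlt_num MQ) [k lt_k ->]|H k /mlt_nat lt_k].
  by rewrite -mnum_scons -(aA M MQ); apply: H; apply/mlt_nat.
by rewrite (aA M MQ) mnum_scons; apply: H; apply/mlt_num => //; exists k.
Qed.

Lemma upward_ball t A : upward A -> upward (ball t A).
Proof.
move=> uA M MQ r; rewrite !msat_ball meval_mnum //.
move=> H x /(mlt_num MQ) [k lt_k ->].
by rewrite -mnum_scons; apply: uA => //; apply: H; apply/mlt_nat.
Qed.

Lemma absolute_bex t A : absolute A -> absolute (bex t A).
Proof.
move=> aA M MQ r; rewrite !msat_bex meval_mnum //.
split=> [[k /mlt_nat lt_k H]|[x /(mlt_num MQ) [k lt_k ->] H]].
  by exists (mnum M k); [apply/mlt_num => //; exists k | rewrite -mnum_scons -(aA M MQ)].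
by exists k; [apply/mlt_nat | rewrite (aA M MQ) mnum_scons].
Qed.

Lemma absolute_ands As : List.Forall absolute As -> absolute (ands As).
Proof.
elim=> {As} [|A As aA _ IH]; first by apply: absolute_Imp.
exact: absolute_And.
Qed.

(** The antecedent has to be carried back to the standard model, hence its absoluteness. In [lfp]
    the antecedent is a set membership. *)
Lemma upward_Imp A B : absolute A -> upward B -> upward (Imp A B).
Proof. by move=> aA uB M MQ r /= H; rewrite -(aA M MQ) => /H; apply: uB. Qed.

Lemma upward_And A B : upward A -> upward B -> upward (And A B).
Proof. by move=> uA uB M MQ r [/(uA M MQ) HA /(uB M MQ)]. Qed.

Lemma upward_Or A B : upward A -> upward B -> upward (Or A B).
Proof. by move=> uA uB M MQ r [/(uA M MQ)|/(uB M MQ)]; [left | right]. Qed.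

Lemma upward_Ex A : upward A -> upward (Ex A).
Proof.
by move=> uA M MQ r [n /(uA M MQ)]; rewrite mnum_scons; exists (mnum M n).
Qed.

Lemma upward_app A ts : upward A -> upward (A @@ ts).
Proof.
move=> uA M MQ r; rewrite /app !msat_subst => /(uA M MQ); congr msat.
by apply: functional_extensionality => i; rewrite meval_mnum.
Qed.

Lemma upward_ands As : List.Forall upward As -> upward (ands As).
Proof.
elim=> {As} [|A As aA _ IH]; first exact/absolute_upward/absolute_Imp.
exact: upward_And.
Qed.

Lemma upward_ors As : List.Forall upward As -> upward (ors As).
Proof.
elim=> {As} [|A As aA _ IH]; first exact/absolute_upward.
exact: upward_Or.
Qed.

Lemma upward_exs n A : upward A -> upward (exs n A).
Proof. by move=> uA; elim: n => //= n; apply: upward_Ex. Qed.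

Lemma delta0_absolute A : delta0 A -> absolute A.
Proof.
elim=> {A} *; [exact: absolute_Bot | exact: absolute_Eq | exact: absolute_Imp
  | exact: absolute_And | exact: absolute_Or | exact: absolute_ball | exact: absolute_bex].
Qed.

Lemma sigma1_upward A : sigma1 A -> upward A.
Proof.
by elim=> {A} [A /delta0_absolute/absolute_upward|A _]; last exact: upward_Ex.
Qed.

Lemma absolute_tmem ts a b d : absolute (tmem ts a b d).
Proof.
apply: absolute_And; last exact/absolute_bex/absolute_Eq.
apply: absolute_ands; elim: ts => [|t ts IH] /=; constructor=> //.
exact: absolute_ltf.
Qed.

Lemma upward_balls n t A : upward A -> upward (balls n t A).
Proof. by elim: n t => //= n IH t /IH uA; apply: upward_ball. Qed.

(** Only the three quantifiers over the code of the set are unbounded. Membership is absolute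
    because its quotient is bounded by [Succ a], and the tuples are bounded by the third component
    of the code. *)
Lemma upward_lfp k step : upward step -> upward (lfp k step).
Proof.
move=> us; apply: upward_exs; apply: upward_And; first exact/absolute_upward/absolute_tmem.
by apply: upward_balls; apply: upward_Imp => //; apply: absolute_tmem.
Qed.

Ltac upward_tac := repeat first
  [ match goal with uA : upward ?A |- upward ?B => constr_eq A B; exact uA end
  | lazymatch goal with
    | |- upward (Eq _ _) => exact/absolute_upward/absolute_Eq
    | |- upward (ltf _ _) => exact/absolute_upward/absolute_ltf
    | |- upward (lef _ _) => exact/absolute_upward/absolute_ltf
    | |- upward (rec _ _ _) => exact/absolute_upward/absolute_tmem
    | |- upward (_ @@ _) => apply: upward_app
    | |- upward (lfp _ _) => apply: upward_lfp
    | |- upward (exs _ _) => apply: upward_exs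
    | |- upward (ands _) => apply: upward_ands
    | |- upward (ors _) => apply: upward_ors
    | |- upward (And _ _) => apply: upward_And
    | |- upward (Or _ _) => apply: upward_Or
    | |- upward (Ex _) => apply: upward_Ex
    | |- List.Forall _ (_ :: _) => apply: List.Forall_cons
    | |- List.Forall _ [::] => apply: List.Forall_nil
    | |- List.Forall _ _ => progress rewrite /=
    | |- upward (let x := ?a in @?F x) => progress cbv zeta beta
    end ].

Lemma upward_len_tm : upward len_tm_f.
Proof. by rewrite /len_tm_f; upward_tac. Qed.

Lemma upward_len_fm : upward len_fm_f.
Proof. by have ? := upward_len_tm; rewrite /len_fm_f; upward_tac. Qed.

Lemma upward_map_tm V : upward V -> upward (map_tm_f V).
Proof. by move=> ?; rewrite /map_tm_f; upward_tac. Qed.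

Lemma upward_map_fm V : upward V -> upward (map_fm_f V).
Proof. by move=> /[dup] ? /upward_map_tm ?; rewrite /map_fm_f; upward_tac. Qed.

(** * Finite sets of tuples *)

(** These are the moduli of Goedel's beta function. A common divisor is prime to [n!], hence divides
    [j - i], hence divides [n!] after all, and so divides 1. *)
Lemma coprime_moduli n i j : i < n -> j < n -> i != j ->
  coprime (i.+1 * n`!).+1 (j.+1 * n`!).+1.
Proof.
wlog lt_ij : i j / i < j => [H lt_in lt_jn ne_ij|lt_in lt_jn _].
  have [lt_ij|lt_ji|E] := ltngtP i j; first exact: H.
    by rewrite coprime_sym; apply: H; rewrite // eq_sym.
  by rewrite E eqxx in ne_ij.
rewrite /coprime -dvdn1; set g := gcdn _ _.
have gi : g %| (i.+1 * n`!).+1 by apply: dvdn_gcdl.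
have gj : g %| (j.+1 * n`!).+1 by apply: dvdn_gcdr.
have co_g : coprime g n`!.
  apply: (coprime_dvdl gi); rewrite -addn1 /coprime gcdnC.
  by rewrite gcdnMDl gcdn1.
have : g %| (j - i) * n`!.
  have -> : (j - i) * n`! = (j.+1 * n`!).+1 - (i.+1 * n`!).+1.
    by rewrite subSS -mulnBl subSS.
  exact: dvdn_sub.
rewrite Gauss_dvdl // => g_ji.
have g_fact : g %| n`!.
  apply: dvdn_trans g_ji _; apply: dvdn_fact; lia.
by have := dvdn_mull i.+1 g_fact => /dvdn_addr <-; rewrite addn1.
Qed.

Lemma finite_set_code (p : pred nat) n :
  exists a b, forall c, c < n -> ((c.+1 * b).+1 %| a) = p c.
Proof.
exists (\prod_(i < n | p i) (i.+1 * n`!).+1), n`! => c lt_cn; apply/idP/idP => [|pc]; last first.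
  by rewrite (bigD1 (Ordinal lt_cn)) //= dvdn_mulr.
move=> dvd_c; apply: contraT => npc.
have co : coprime (c.+1 * n`!).+1 (\prod_(i < n | p i) (i.+1 * n`!).+1).
  apply: (big_ind (fun m => coprime _ m)) => [|x y cx cy|i pi]; first exact: coprimen1.
    by rewrite coprimeMr cx.
  apply: coprime_moduli => //; by apply: contraNneq npc => ->.
(* A modulus that divides [a] and is prime to it equals 1, which would make [c.+1 * n!] vanish. *)
move: co; rewrite /coprime (gcdn_idPl dvd_c) eqSS muln_eq0 /=.
by rewrite -leqn0 leqNgt fact_gt0.
Qed.

(** The seed [False -> False] is the meaning of [Not Bot], the formula with which [ands] ends. *)
Definition mtmem (M : structure) (ts : seq M) (a b d : M) : Prop :=
  foldr (fun t P => mlt t d /\ P) (False -> False) ts /\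
  exists q, mlt q (sS a) /\
    smul q (sS (smul (sS (foldr (@mpair M) (s0 M) ts)) b)) = a.

Lemma msat_tmem (M : structure) (r : nat -> M) ts a b d :
  msat r (tmem ts a b d) <-> mtmem (map (meval r) ts) (meval r a) (meval r b) (meval r d).
Proof.
rewrite /tmem /mtmem; set As := ands _; set B := Eq _ _.
have -> : msat r (And As (bex (Succ a) B)) = (msat r As /\ msat r (bex (Succ a) B)) by [].
have cE : meval r (foldr cpair Zero ts) = foldr (@mpair M) (s0 M) (map (meval r) ts).
  by elim: (ts) => //= t us <-.
have BE q : msat (scons q r) B =
    (smul q (sS (smul (sS (meval (scons q r) (shift_tm (foldr cpair Zero ts))))
                      (meval (scons q r) (shift_tm b))))
     = meval (scons q r) (shift_tm a)) by [].
suff AsE : msat r As <->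
    foldr (fun t P => mlt t (meval r d) /\ P) (False -> False) (map (meval r) ts).
  rewrite msat_bex AsE; split=> -[H [q]].
    by rewrite BE !meval_shift cE => lt_q E; split=> //; exists q.
  by move=> [lt_q E]; split=> //; exists q; rewrite // BE !meval_shift cE.
rewrite {B BE cE}/As.
by elim: ts => // t ts IH; rewrite /= -IH -msat_ltf.
Qed.

Definition tcode : seq nat -> nat := foldr npair 0.

Lemma tcode_inj xs ys : size xs = size ys -> tcode xs = tcode ys -> xs = ys.
Proof.
by elim: xs ys => [|x xs IH] [|y ys] //= [/IH eq_s] /npair_inj [-> /eq_s ->].
Qed.

Lemma tcode_bound k d : exists n, forall ts, size ts = k ->
  all (fun t => t < d) ts -> tcode ts < n.
Proof.
elim: k => [|k [n IH]]; first by exists 1 => -[].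
exists (npair d n).+1 => -[//|t ts] /= [/IH lt_ts] /andP [lt_td /lt_ts].
rewrite /tcode /= -/(tcode ts) /npair => lt_c.
by rewrite ltnS; apply: leq_add; [apply: leq_mul | ]; lia.
Qed.

Lemma mtmem_nat ts a b d : @mtmem natM ts a b d <->
  all (fun t => t < d) ts /\ ((tcode ts).+1 * b).+1 %| a.
Proof.
rewrite /mtmem; suff -> : foldr (fun t P => @mlt natM t d /\ P) (False -> False) ts <->
    all (fun t => t < d) ts.
  split=> -[ts_d]; first by move=> [q [_ E]]; split=> //; apply/dvdnP; exists q.
  move=> /dvdnP [q E]; split=> //; exists q; split=> //; apply/mlt_nat.
  by rewrite E ltnS leq_pmulr.
elim: ts => //= t ts ->; rewrite mlt_nat.
by split=> [[-> ->]|/andP].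
Qed.

Lemma tuple_set_code k (L : seq (seq nat)) : all (fun ts => size ts == k) L ->
  exists a b d, forall ts, size ts = k -> (@mtmem natM ts a b d <-> ts \in L).
Proof.
move=> Lk; have [d Ld] : exists d, forall ts, ts \in L -> all (fun t => t < d) ts.
  exists (\max_(t <- flatten L) t).+1 => ts tsL; apply/allP => t t_ts.
  rewrite ltnS; apply: (leq_bigmax_seq (P := xpredT) (F := id)) => //.
  by apply/flattenP; exists ts.
have [n bn] := tcode_bound k d.
have [a [b ab]] := finite_set_code [pred c | c \in map tcode L] n.
exists a, b, d => ts ts_k; rewrite mtmem_nat; split.
  move=> [ts_d]; rewrite ab ?bn //= => /mapP [ts' ts'L /tcode_inj -> //].
  by rewrite ts_k (eqP (allP Lk _ ts'L)).
move=> tsL; have ts_d := Ld _ tsL; split=> //.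
by rewrite ab ?bn //=; apply: map_f.
Qed.

(** * Inductive relations in the standard model *)

(** Asking for [step] in every code of a superset of [L], rather than in one code of [L], makes
    justified lists closed under union, so separate derivations can be merged. *)
Definition justified (k : nat) (step : fm) (L : seq (seq nat)) : Prop :=
  forall ts, ts \in L -> size ts = k /\
    forall a b d r, (forall us, us \in L -> @mtmem natM us a b d) ->
      @msat natM (foldr (@scons nat) r (ts ++ [:: a; b; d])) step.

Definition derivable (k : nat) (step : fm) (ts : seq nat) : Prop :=
  exists2 L : seq (seq nat), justified k step L & ts \in L.

Lemma derivable_step k step us ts :
  (forall u, u \in (us : seq (seq nat)) -> derivable k step u) -> size ts = k ->
  (forall a b d r, (forall u, u \in us -> @mtmem natM u a b d) ->
     @msat natM (foldr (@scons nat) r (ts ++ [:: a; b; d])) step) ->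
  derivable k step ts.
Proof.
move=> dus ts_k Hts.
have [L jL usL] : exists2 L : seq (seq nat), justified k step L & {subset us <= L}.
  elim: us dus {Hts} => [|u us IH] dus; first by exists [::].
  have [|L jL usL] := IH; first by move=> v v_us; apply: dus; rewrite inE v_us orbT.
  have [L' jL' uL'] := dus u (mem_head _ _).
  exists (L' ++ L) => [v|v].
    rewrite mem_cat => /orP [/jL'|/jL] [v_k Hv]; split=> // a b d r H;
    by apply: Hv => w wL; apply: H; rewrite mem_cat wL ?orbT.
  by rewrite inE mem_cat => /predU1P [->|/usL ->]; rewrite ?uL' ?orbT.
exists (ts :: L); last exact: mem_head.
move=> v; rewrite inE => /predU1P [->|/jL [v_k Hv]]; split=> // a b d r H.
  by apply: Hts => u /usL uL; apply: H; rewrite inE uL orbT.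
by apply: Hv => u uL; apply: H; rewrite inE uL orbT.
Qed.

Lemma foldr_scons (X : Type) x0 (r : nat -> X) xs i :
  foldr (@scons X) r xs i = if i < size xs then nth x0 xs i else r (i - size xs).
Proof. by elim: xs i => [|x xs IH] [|i] //=; rewrite ?subn0 // IH. Qed.

Lemma msat_balls (M : structure) (r : nat -> M) n t A :
  (forall xs, size xs = n -> msat (foldr (@scons M) r xs) A) -> msat r (balls n t A).
Proof.
elim: n r t => [|n IH] r t H; first exact: (H [::]).
apply/msat_ball => x _; apply: IH => xs xs_n.
(* The first quantifier opened is the outermost one, whose value ends up last in the list. *)
by have := H (rcons xs x); rewrite size_rcons xs_n foldr_rcons; apply.
Qed.

Lemma map_meval_iota (M : structure) (r : nat -> M) xs m :
  (forall i, i < size xs -> r (m + i) = nth (s0 M) xs i) ->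
  map (meval r) [seq Var i | i <- iota m (size xs)] = xs.
Proof.
move=> H; rewrite -map_comp; apply: (@eq_from_nth _ (s0 M)); rewrite size_map size_iota //.
by move=> i lt_i; rewrite (nth_map 0) ?size_iota // nth_iota //=; apply: H.
Qed.

Lemma lfp_derivable k step ts r : derivable k step ts ->
  (forall i, i < k -> r i = nth 0 ts i) -> @msat natM r (lfp k step).
Proof.
move=> [L jL tsL] rE; have ts_k := (jL _ tsL).1.
have [|a [b [d abd]]] := @tuple_set_code k L.
  by apply/allP => us /jL [->].
(* The outermost of the three existentials is index 2, the bound [d]. *)
exists d, b, a; split.
  apply/msat_tmem; rewrite -{1}ts_k map_meval_iota ?ts_k => [|i lt_i]; last exact: rE.
  by apply/abd.
apply: msat_balls => us us_k.
have envE j : foldr (@scons nat) (scons a (scons b (scons d r))) us (k + j)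
              = scons a (scons b (scons d r)) j.
  by rewrite (foldr_scons 0) us_k ltnNge leq_addr addKn.
move=> H; have usL : us \in L.
  move/msat_tmem: H; rewrite -!addnS -{1}us_k map_meval_iota; last first.
    by move=> i lt_i; rewrite (foldr_scons 0) lt_i.
  by rewrite /= !envE => /(abd us us_k).
have := (jL us usL).2 a b d r; rewrite foldr_cat; apply => v vL.
by apply/abd => //; apply: (jL v vL).1.
Qed.

(** * Truth of the arithmetized notions *)

Notation nsat := (@msat natM).

Lemma msat_app (M : structure) (r : nat -> M) F ts :
  msat r (F @@ ts) = msat (fun i => meval r (nth Zero ts i)) F.
Proof. exact: msat_subst. Qed.

Lemma derivable0 k step ts : size ts = k ->
  (forall a b d r, nsat (foldr (@scons nat) r (ts ++ [:: a; b; d])) step) ->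
  derivable k step ts.
Proof. by move=> ts_k H; apply: (@derivable_step k step [::]). Qed.

Lemma derivable1 k step u ts : derivable k step u -> size ts = k ->
  (forall a b d r, @mtmem natM u a b d ->
     nsat (foldr (@scons nat) r (ts ++ [:: a; b; d])) step) ->
  derivable k step ts.
Proof.
move=> du ts_k H; apply: (@derivable_step k step [:: u]) => // [v|a b d r Hu].
  by rewrite inE => /eqP ->.
by apply: H; apply: Hu; rewrite inE.
Qed.

Lemma derivable2 k step u v ts : derivable k step u -> derivable k step v ->
  size ts = k ->
  (forall a b d r, @mtmem natM u a b d -> @mtmem natM v a b d ->
     nsat (foldr (@scons nat) r (ts ++ [:: a; b; d])) step) ->
  derivable k step ts.
Proof.
move=> du dv ts_k H; apply: (@derivable_step k step [:: u; v]) => // [w|a b d r Hu].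
  by rewrite !inE => /orP [] /eqP ->.
by apply: H; apply: Hu; rewrite !inE eqxx ?orbT.
Qed.

Lemma len_tm_true t r : r 0 = code_tm t -> r 1 = len_tm t -> nsat r len_tm_f.
Proof.
move=> r0 r1; apply: (lfp_derivable (ts := [:: code_tm t; len_tm t])); last by case=> [|[]].
set st := ors _; elim: t {r r0 r1} => [i||t dt|t dt u du|t dt u du].
- by apply: derivable0 => // a b d r; left; exists i.
- by apply: derivable0 => // a b d r; right; left.
- apply: derivable1 dt _ _ => // a b d r Ht; right; right; left.
  (* Here and below, witnesses go from the outermost quantifier inwards, so against the order of the
     indices [$0], [$1], ... in the clause. *)
  by exists (len_tm t), (code_tm t); split; [apply/msat_tmem | split; [|split]].
- apply: derivable2 dt du _ _ => // a b d r Ht Hu; do 3 right; left.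
  exists (len_tm u), (len_tm t), (code_tm u), (code_tm t).
  split; [by apply/msat_tmem | split; [by apply/msat_tmem | split; last by split]].
  by left.
- apply: derivable2 dt du _ _ => // a b d r Ht Hu; do 3 right; left.
  exists (len_tm u), (len_tm t), (code_tm u), (code_tm t).
  split; [by apply/msat_tmem | split; [by apply/msat_tmem | split; last by split]].
  by right; left.
Qed.

Lemma len_fm_true A r : r 0 = code A -> r 1 = len_fm A -> nsat r len_fm_f.
Proof.
move=> r0 r1; apply: (lfp_derivable (ts := [:: code A; len_fm A])); last by case=> [|[]].
set st := ors _.
have bin k f g c l : List.In k [:: 7; 8; 9] ->
    derivable 2 st [:: code f; len_fm f] -> derivable 2 st [:: code g; len_fm g] ->
    c = npair k (npair (code f) (code g)) -> l = len_fm f + len_fm g + 3 ->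
    derivable 2 st [:: c; l].
  move=> /= kE df dg -> ->; apply: derivable2 df dg _ _ => // a b d r' Hf Hg.
  right; right; left; exists (len_fm g), (len_fm f), (code g), (code f).
  split; [by apply/msat_tmem | split; [by apply/msat_tmem | split; last by split]].
  by case: kE => [<-|[<-|[<-|//]]]; [left | right; left | right; right; left].
have un k f c : List.In k [:: 10; 11] ->
    derivable 2 st [:: code f; len_fm f] -> c = npair k (code f) ->
    derivable 2 st [:: c; len_fm f + 2].
  move=> /= kE df ->; apply: derivable1 df _ _ => // a b d r' Hf.
  do 3 right; left; exists (len_fm f), (code f).
  split; [by apply/msat_tmem | split; last by split].
  by case: kE => [<-|[<-|//]]; [left | right; left].
elim: A {r r0 r1} => [|t u|A dA B dB|A dA B dB|A dA B dB|A dA|A dA].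
- by apply: derivable0 => // a b d r; left.
- apply: derivable0 => // a b d r; right; left.
  exists (len_tm u), (len_tm t), (code_tm u), (code_tm t).
  split; [|split; last by do !split].
    by rewrite msat_app; apply: (len_tm_true (t := t)).
  by rewrite msat_app; apply: (len_tm_true (t := u)).
- by apply: (bin 7) dA dB _ _ => //; left.
- by apply: (bin 8) dA dB _ _ => //; right; left.
- by apply: (bin 9) dA dB _ _ => //; right; right; left.
- by apply: (un 10) dA _ => //; left.
- by apply: (un 11) dA _ => //; right; left.
Qed.

Lemma is_tm_true t u r : @meval natM r u = code_tm t -> nsat r (is_tm u).
Proof.
move=> E; exists (len_tm t); rewrite msat_app.
by apply: (len_tm_true (t := t)) => //=; rewrite meval_shift.
Qed.

Lemma is_fm_true A u r : @meval natM r u = code A -> nsat r (is_fm u).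
Proof.
move=> E; exists (len_fm A); rewrite msat_app.
by apply: (len_fm_true (A := A)) => //=; rewrite meval_shift.
Qed.

Lemma map_tm_true V s c p t r :
  (forall n r, r 0 = n -> r 1 = c -> r 2 = p -> r 3 = code_tm (s n) -> nsat r V) ->
  r 0 = code_tm t -> r 1 = c -> r 2 = p -> r 3 = code_tm (subst_tm s t) ->
  nsat r (map_tm_f V).
Proof.
move=> VP r0 r1 r2 r3.
apply: (lfp_derivable (ts := [:: code_tm t; c; p; code_tm (subst_tm s t)])); last first.
  by case=> [|[|[|[]]]].
set st := ors _; elim: t {r r0 r1 r2 r3} => [i||t dt|t dt u du|t dt u du].
- apply: derivable0 => // a b d r; left; exists i; split; first by [].
  by rewrite msat_app; apply: (VP i).
- by apply: derivable0 => // a b d r; right; left.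
- apply: derivable1 dt _ _ => // a b d r Ht; right; right; left.
  exists (code_tm (subst_tm s t)), (code_tm t).
  by split; [apply/msat_tmem | split; [|split]].
- apply: derivable2 dt du _ _ => // a b d r Ht Hu; do 3 right; left.
  exists (code_tm (subst_tm s u)), (code_tm (subst_tm s t)), (code_tm u), (code_tm t).
  split; [by apply/msat_tmem | split; [by apply/msat_tmem | split; last by []]].
  by left.
- apply: derivable2 dt du _ _ => // a b d r Ht Hu; do 3 right; left.
  exists (code_tm (subst_tm s u)), (code_tm (subst_tm s t)), (code_tm u), (code_tm t).
  split; [by apply/msat_tmem | split; [by apply/msat_tmem | split; last by []]].
  by right; left.
Qed.

Lemma map_fm_true V s p A r :
  (forall c n r, r 0 = n -> r 1 = c -> r 2 = p -> r 3 = code_tm (iter c up s n) ->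
     nsat r V) ->
  r 0 = code A -> r 1 = 0 -> r 2 = p -> r 3 = code (subst_fm s A) ->
  nsat r (map_fm_f V).
Proof.
move=> VP r0 r1 r2 r3.
apply: (lfp_derivable (ts := [:: code A; 0; p; code (subst_fm s A)])); last first.
  by case=> [|[|[|[]]]].
set st := ors _.
pose out c A := code (subst_fm (iter c up s) A).
have bin k f g c x y : List.In k [:: 7; 8; 9] ->
    derivable 4 st [:: code f; c; p; out c f] -> derivable 4 st [:: code g; c; p; out c g] ->
    x = npair k (npair (code f) (code g)) -> y = npair k (npair (out c f) (out c g)) ->
    derivable 4 st [:: x; c; p; y].
  move=> /= kE df dg -> ->; apply: derivable2 df dg _ _ => // a b d r' Hf Hg.
  right; right; left; exists (out c g), (out c f), (code g), (code f).
  split; [by apply/msat_tmem | split; [by apply/msat_tmem | split; last by []]].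
  by case: kE => [<-|[<-|[<-|//]]]; [left | right; left | right; right; left].
have un k f c x y : List.In k [:: 10; 11] ->
    derivable 4 st [:: code f; c.+1; p; out c.+1 f] ->
    x = npair k (code f) -> y = npair k (out c.+1 f) ->
    derivable 4 st [:: x; c; p; y].
  move=> /= kE df -> ->; apply: derivable1 df _ _ => // a b d r' Hf.
  do 3 right; left; exists (out c.+1 f), (code f).
  split; [by apply/msat_tmem | split; last by []].
  by case: kE => [<-|[<-|//]]; [left | right; left].
(* The depth c must vary in the induction: the body of a quantifier is treated at depth [c.+1]. *)
suff : forall c, derivable 4 st [:: code A; c; p; out c A] by apply.
elim: A {r r0 r1 r2 r3} => [|t u|A dA B dB|A dA B dB|A dA B dB|A dA|A dA] c.
- by apply: derivable0 => // a b d r; left.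
- apply: derivable0 => // a b d r; right; left.
  exists (code_tm (subst_tm (iter c up s) u)), (code_tm (subst_tm (iter c up s) t)).
  exists (code_tm u), (code_tm t).
  split; [|split; last by do !split].
    by rewrite msat_app; apply: (map_tm_true (t := t) (VP c)).
  by rewrite msat_app; apply: (map_tm_true (t := u) (VP c)).
- by apply: (bin 7) (dA c) (dB c) _ _ => //; left.
- by apply: (bin 8) (dA c) (dB c) _ _ => //; right; left.
- by apply: (bin 9) (dA c) (dB c) _ _ => //; right; right; left.
- by apply: (un 10) (dA c.+1) _ _ => //; left.
- by apply: (un 11) (dA c.+1) _ _ => //; right; left.
Qed.

(** With [iter_up_ge], this computes a substitution under c binders: bound variables stay, the
    others receive a lifted image. The clauses of [shift_var], [diag_var] and [inst_var] follow the
    same case distinction. *)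
Lemma iter_up_lt c s n : n < c -> iter c up s n = Var n.
Proof. by elim: c n => // c IH [|n] //=; rewrite ltnS /shift_tm => /IH ->. Qed.

Lemma iter_up_ge c s n : iter c up s (c + n) = subst_tm (fun i => Var (i + c)) (s n).
Proof.
elim: c => [|c IH] /=; first by rewrite -[LHS]subst_tm_id; congr subst_tm;
  apply: functional_extensionality => i; rewrite addn0.
rewrite IH /shift_tm subst_tm_comp; congr subst_tm.
by apply: functional_extensionality => i /=; rewrite addnS.
Qed.

Lemma msat_lef_nat t u r : nsat r (lef t u) <-> @meval natM r t <= @meval natM r u.
Proof. by rewrite /lef msat_ltf mlt_nat. Qed.

Lemma shift_true A x y r : @meval natM r x = code A ->
  @meval natM r y = code (shift_fm A) -> nsat r (shift_f x y).
Proof.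
move=> Ex Ey; rewrite /shift_f msat_app; apply: map_fm_true Ex erefl erefl Ey.
move=> c n r' r0 r1 r2; have [lt_nc|le_cn] := ltnP n c.
  rewrite iter_up_lt // => r3; left; split; last by rewrite /= r3 r0.
  by apply/msat_ltf/mlt_nat; rewrite /= r0 r1.
rewrite -(subnKC le_cn) iter_up_ge => r3; simpl in r3; right; split.
  by apply/msat_lef_nat; rewrite /= r0 r1.
by rewrite /= r3 r0 addSn addnC subnKC.
Qed.

Lemma diag_true A x y r : @meval natM r x = code A ->
  @meval natM r y = code (diag A) -> nsat r (diag_f x y).
Proof.
move=> Ex Ey; rewrite /diag_f msat_app; apply: map_fm_true Ex erefl erefl Ey.
move=> c n r' r0 r1 r2; have [lt_nc|le_cn] := ltnP n c.
  rewrite iter_up_lt // => r3; left; split; last by rewrite /= r3 r0.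
  by apply/msat_ltf/mlt_nat; rewrite /= r0 r1.
rewrite -(subnKC le_cn) iter_up_ge => r3; simpl in r3; right; split.
  by apply/msat_lef_nat; rewrite /= r0 r1.
by rewrite /= r3 r1.
Qed.

Lemma inst_true t A p x y r : @meval natM r p = code_tm t ->
  @meval natM r x = code A -> @meval natM r y = code (inst t A) ->
  nsat r (inst_f p x y).
Proof.
move=> Ep Ex Ey; rewrite /inst_f msat_app; apply: map_fm_true Ex erefl Ep Ey.
move=> c n r' r0 r1 r2; have [lt_nc|] := ltnP n c.
  rewrite iter_up_lt // => r3; left; split; last by rewrite /= r3 r0.
  by apply/msat_ltf/mlt_nat; rewrite /= r0 r1.
(* The variable n = c is the one instantiated. Its image is [t] lifted past c binders, which the
   inner [map_tm_f lift_var] describes. *)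
rewrite leq_eqVlt => /predU1P [En|lt_cn].
  have -> : iter c up (scons t Var) n = subst_tm (fun i => Var (i + c)) t.
    by rewrite -En -{2}[c]addn0 iter_up_ge.
  move=> r3; right; left.
  split; first by rewrite /= r0 r1.
  rewrite msat_app; apply: (map_tm_true (s := fun i => Var (i + c)) (t := t)) r2 r1 erefl r3.
  by move=> i r'' i0 i1 i2 i3; rewrite /= i3 i0 i1.
(* A variable beyond the instantiated one drops by 1, since a binder has disappeared. *)
case: n lt_cn r0 => // n; rewrite ltnS => le_cn r0.
rewrite -(subnKC le_cn) -addnS iter_up_ge => r3; simpl in r3; right; right; left; exists n.
split; first by rewrite /= r0.
by split; [apply/msat_lef_nat; rewrite /= r1 | split; rewrite //= r3 addnC subnKC].
Qed.

Lemma nat_cpair r t u : @meval natM r (cpair t u) = npair (meval r t) (meval r u).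
Proof. by []. Qed.

Lemma nat_numeral r n : @meval natM r (numeral n) = n.
Proof. by rewrite meval_numeral mnum_nat. Qed.

Lemma msat_Eq (M : structure) (r : nat -> M) t u :
  msat r (Eq t u) = (meval r t = meval r u).
Proof. by []. Qed.

(* Deciding these equations by conversion would unfold the nested pairs. *)
Ltac by_codes E :=
  rewrite msat_Eq /cImp /cAnd /cOr /cAll /cEx /cEq /cBot /cVar /cSucc /cZero /cbin /cun;
  rewrite !(nat_cpair, nat_numeral); exact: E.

Lemma logax_true A r : logax A -> r 0 = code A -> nsat r logax_f.
Proof.
case=> {A}.
- move=> A B E; left; exists (code B), (code A).
  split; first exact: (is_fm_true (A := A)).
  split; first exact: (is_fm_true (A := B)).
  by split; first by_codes E.
- move=> A B C E; right; left; exists (code C), (code B), (code A).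
  split; first exact: (is_fm_true (A := A)).
  split; first exact: (is_fm_true (A := B)).
  split; first exact: (is_fm_true (A := C)).
  by split; first by_codes E.
- move=> A E; do 2 right; left; exists (code A).
  split; first exact: (is_fm_true (A := A)).
  by_codes E.
- move=> A B E; do 3 right; left; exists (code B), (code A).
  split; first exact: (is_fm_true (A := A)).
  split; first exact: (is_fm_true (A := B)).
  by split; first by left; by_codes E.
- move=> A B E; do 3 right; left; exists (code B), (code A).
  split; first exact: (is_fm_true (A := A)).
  split; first exact: (is_fm_true (A := B)).
  by split; first by right; left; by_codes E.
- move=> A B E; do 3 right; left; exists (code B), (code A).
  split; first exact: (is_fm_true (A := A)).
  split; first exact: (is_fm_true (A := B)).
  by split; first by do 2 right; left; by_codes E.
- move=> A B E; do 3 right; left; exists (code B), (code A).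
  split; first exact: (is_fm_true (A := A)).
  split; first exact: (is_fm_true (A := B)).
  by split; first by do 3 right; left; by_codes E.
- move=> A B E; do 3 right; left; exists (code B), (code A).
  split; first exact: (is_fm_true (A := A)).
  split; first exact: (is_fm_true (A := B)).
  by split; first by do 4 right; left; by_codes E.
- move=> A B C E; do 4 right; left; exists (code C), (code B), (code A).
  split; first exact: (is_fm_true (A := A)).
  split; first exact: (is_fm_true (A := B)).
  split; first exact: (is_fm_true (A := C)).
  by split; first by_codes E.
- move=> A t E; do 5 right; left; exists (code (inst t A)), (code_tm t), (code A).
  split; first exact: (is_fm_true (A := A)).
  split; first exact: (is_tm_true (t := t)).
  split; first exact: (inst_true (t := t) (A := A)).
  by split; first by left; by_codes E.
- move=> A B E; do 6 right; left; exists (code (shift_fm A)), (code B), (code A).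
  split; first exact: (is_fm_true (A := A)).
  split; first exact: (is_fm_true (A := B)).
  split; first exact: (shift_true (A := A)).
  by split; first by left; by_codes E.
- move=> A t E; do 5 right; left; exists (code (inst t A)), (code_tm t), (code A).
  split; first exact: (is_fm_true (A := A)).
  split; first exact: (is_tm_true (t := t)).
  split; first exact: (inst_true (t := t) (A := A)).
  by split; first by right; by_codes E.
(* This clause is shared with [lAllI]; its first formula is the one that gets shifted, here [B], so
   the roles of [A] and [B] are exchanged. *)
- move=> A B E; do 6 right; left; exists (code (shift_fm B)), (code A), (code B).
  split; first exact: (is_fm_true (A := B)).
  split; first exact: (is_fm_true (A := A)).
  split; first exact: (shift_true (A := B)).
  by split; first by right; by_codes E.
- move=> t E; do 7 right; left; exists (code_tm t).
  split; first exact: (is_tm_true (t := t)).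
  by_codes E.
- move=> A t u E; do 8 right; left.
  exists (code (inst u A)), (code (inst t A)), (code_tm u), (code_tm t), (code A).
  split; first exact: (is_fm_true (A := A)).
  split; first exact: (is_tm_true (t := t)).
  split; first exact: (is_tm_true (t := u)).
  split; first exact: (inst_true (t := t) (A := A)).
  split; first exact: (inst_true (t := u) (A := A)).
  by split; first by_codes E.
Qed.

Lemma msat_below1 (M : structure) (r : nat -> M) A :
  fm_below 1 A -> msat r A = msat (fun _ => r 0) A.
Proof.
move=> bA; rewrite -{1}[A]subst_fm_id.
by rewrite (subst_fm_below (s' := fun _ => Var 0) bA) ?msat_subst // => -[].
Qed.

(** The height of the derivation serves as line number: 0 for axioms, and one more than the largest
    premise at an inference. *)
Lemma Pr_true T tau A u r : presents tau T -> prv T A ->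
  @meval natM r u = code A -> nsat r (Pr tau u).
Proof.
move=> [_ b_tau tauP] pA Eu; rewrite /Pr /proof_line_f; set st := ors _.
suff [i di] : exists i, derivable 2 st [:: code A; i].
  exists i; rewrite msat_app; apply: lfp_derivable di _.
  by case=> [|[]] //= _; rewrite meval_shift.
elim: pA {r u Eu} => {A} [A TA|A lA|A B _ [i dAB] _ [j dA]|A _ [i dA]].
- exists 0; apply: derivable0 => // a b d r; left.
  rewrite msat_app msat_below1 //; apply/sat_natM/tauP; by exists A.
- exists 0; apply: derivable0 => // a b d r; right; left.
  by rewrite msat_app; apply: logax_true lA _.
- exists (maxn i j).+1; apply: derivable2 dAB dA _ _ => // a b d r HAB HA.
  do 2 right; left; exists j, i, (code A).
  split; first by apply/msat_ltf/mlt_nat; rewrite /= ltnS leq_maxl.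
  split; first by apply/msat_ltf/mlt_nat; rewrite /= ltnS leq_maxr.
  by split; [apply/msat_tmem | split; first exact/msat_tmem].
- exists i.+1; apply: derivable1 dA _ _ => // a b d r HA.
  do 3 right; left; exists i, (code A).
  split; first by apply/msat_ltf/mlt_nat; rewrite /= ltnSn.
  by split; [exact/msat_tmem | split].
Qed.

Lemma num_true n r : r 0 = n -> r 1 = code_tm (numeral n) -> nsat r num_f.
Proof.
move=> r0 r1; apply: (lfp_derivable (ts := [:: n; code_tm (numeral n)])); last by case=> [|[]].
set st := ors _; elim: n {r r0 r1} => [|n dn].
  by apply: derivable0 => // a b d r; left.
apply: derivable1 dn _ _ => // a b d r Hn; right; left.
exists (code_tm (numeral n)), n.
by split; [apply/msat_tmem | split; [|split]].
Qed.

Lemma D_true A n r : r 0 = code A -> r 1 = n -> r 2 = code (D_fm A n) -> nsat r D_f.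
Proof.
move=> r0 r1 r2; exists (code_tm (numeral n)), (code (diag A)).
split; first by apply: (diag_true (A := A)).
split; first by rewrite msat_app; apply: (num_true (n := n)).
by split; first by_codes r2.
Qed.

Lemma len_lt_true A x z r : @meval natM r x = code A -> len_fm A < @meval natM r z ->
  nsat r (len_lt x z).
Proof.
move=> Ex lt_z; exists (len_fm A); split.
  by rewrite msat_app; apply: (len_fm_true (A := A)) => //=; rewrite meval_shift.
by apply/msat_ltf/mlt_nat; rewrite /= meval_shift.
Qed.

Lemma Def_true T tau A n y z r : presents tau T -> prv T (D_fm A n) ->
  @meval natM r y = n -> len_fm A < @meval natM r z -> nsat r (Def tau z y).
Proof.
move=> tauP pD Ey lt_z; exists (code A); split.
  by apply: len_lt_true; rewrite ?meval_shift.
exists (code (D_fm A n)); split; last exact: Pr_true tauP pD _.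
by rewrite msat_app; apply: (D_true (A := A) (n := n)); rewrite //= ?meval_shift.
Qed.

(** * Upward preservation of the provability and definability formulas *)

Lemma upward_shift x y : upward (shift_f x y).
Proof. by apply/upward_app/upward_map_fm; rewrite /shift_var; upward_tac. Qed.

Lemma upward_diag x y : upward (diag_f x y).
Proof. by apply/upward_app/upward_map_fm; rewrite /diag_var; upward_tac. Qed.

Lemma upward_inst p x y : upward (inst_f p x y).
Proof.
apply/upward_app/upward_map_fm; rewrite /inst_var; upward_tac.
by apply: upward_map_tm; rewrite /lift_var; upward_tac.
Qed.

Lemma upward_is_tm t : upward (is_tm t).
Proof. by rewrite /is_tm; have ? := upward_len_tm; upward_tac. Qed.

Lemma upward_is_fm t : upward (is_fm t).
Proof. by rewrite /is_fm; have ? := upward_len_fm; upward_tac. Qed.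

Lemma upward_logax : upward logax_f.
Proof.
rewrite /logax_f; repeat (upward_tac; lazymatch goal with
  | |- upward (is_tm _) => exact: upward_is_tm
  | |- upward (is_fm _) => exact: upward_is_fm
  | |- upward (shift_f _ _) => exact: upward_shift
  | |- upward (inst_f _ _ _) => exact: upward_inst
  end).
Qed.

Lemma upward_Pr T tau u : presents tau T -> upward (Pr tau u).
Proof.
move=> [/sigma1_upward ? _ _]; have ? := upward_logax.
by rewrite /Pr /proof_line_f; upward_tac.
Qed.

Lemma upward_Def T tau z y : presents tau T -> upward (Def tau z y).
Proof.
move=> /upward_Pr uP; have ? := upward_len_fm.
apply: upward_Ex; apply: upward_And; first by rewrite /len_lt; upward_tac.
apply: upward_Ex; apply: upward_And; last exact: uP.
rewrite /D_f; upward_tac; first exact: upward_diag.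
by rewrite /num_f; upward_tac.
Qed.

(** * Codes of bounded length in a model of Q *)

Definition closed_set (M : structure) step (r : nat -> M) (a b d : M) : Prop :=
  forall x y, mtmem [:: x; y] a b d ->
    msat (scons x (scons y (scons a (scons b (scons d r))))) step.

(** The triple may be nonstandard, so the coded set may be infinite. All that survives is that each
    member is justified by members, which suffices for descending along a standard length. *)
Lemma lfp2_elim (M : structure) (r : nat -> M) step : msat r (lfp 2 step) ->
  exists a b d, closed_set step r a b d /\ mtmem [:: r 0; r 1] a b d.
Proof.
have -> : msat r (lfp 2 step) = exists d b a, let e := scons a (scons b (scons d r)) in
    msat e (tmem [:: $3; $4] $0 $1 $2) /\
    msat e (ball $2 (ball $3 (Imp (rec 2 0 [:: $0; $1]) step))) by [].
move=> [d [b [a [/msat_tmem mem_r /msat_ball cl]]]]; exists a, b, d; split=> // x y mem_xy.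
(* Membership itself contains the bounds by [d] that the two bounded quantifiers of [lfp] ask for;
   the outer one binds [y]. *)
have [[lt_x [lt_y _]] _] := mem_xy.
have rec_xy : msat (scons x (scons y (scons a (scons b (scons d r)))))
                   (rec 2 0 [:: $0; $1]) by apply/msat_tmem.
by have /msat_ball/(_ x lt_x) := cl _ lt_y; apply.
Qed.

Definition in_codes (M : structure) (L : seq nat) (x : M) : Prop :=
  exists2 n, n \in L & x = mnum M n.

(** An overestimate of one application of a constructor: all twelve tags are combined with all
    components, sensible or not. Only finiteness of the list is at stake. *)
Definition code_step (L : seq nat) : seq nat :=
  [seq npair k t | k <- iota 0 12, t <- L] ++
  [seq npair k c | k <- iota 0 12, c <- [seq npair t u | t <- L, u <- L]].

Section BoundedLength.

Variables (M : structure) (MQ : model M Q).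

Lemma in_codes_un L k (x : M) : k < 12 -> in_codes L x ->
  in_codes (code_step L) (mpair (mnum M k) x).
Proof.
move=> lt_k [n nL ->]; exists (npair k n); last exact: mnum_pair.
by rewrite mem_cat allpairs_f // mem_iota.
Qed.

Lemma in_codes_bin L k (x y : M) : k < 12 -> in_codes L x -> in_codes L y ->
  in_codes (code_step L) (mpair (mnum M k) (mpair x y)).
Proof.
move=> lt_k [m mL ->] [n nL ->]; exists (npair k (npair m n)).
  by rewrite mem_cat [X in _ || X]allpairs_f ?orbT ?mem_iota // allpairs_f.
by rewrite !mnum_pair.
Qed.

Lemma in_codes_sub L L' (x : M) : {subset L <= L'} -> in_codes L x -> in_codes L' x.
Proof. by move=> sLL' [n /sLL' nL ->]; exists n. Qed.

Lemma in_codes_num L n : n \in L -> @in_codes M L (mnum M n).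
Proof. by move=> nL; exists n. Qed.

(** Induction on the standard number N, outside the model: when an entry has standard length,
    [madd_eq_num] makes the lengths of its components standard and smaller. They belong to the same
    coded set, so the list must not depend on the set. *)
Lemma len_tm_codes N : exists L, forall (r : nat -> M) n,
  n < N -> r 1 = mnum M n -> msat r len_tm_f -> in_codes L (r 0).
Proof.
rewrite /len_tm_f; set st := ors _.
suff [L LP] : exists L, forall (r : nat -> M) a b d n x, n < N ->
    closed_set st r a b d -> mtmem [:: x; mnum M n] a b d -> in_codes L x.
  exists L => r n lt_n r1 /lfp2_elim [a [b [d [cl]]]]; rewrite r1.
  exact: LP lt_n cl.
elim: N => [|N [L IH]]; first by exists [::].
(* [N.-1] is the index of the only variable of length N, and 0 is the second component of the code
   of [Zero]. *)
exists (L ++ code_step [:: N.-1, 0 & L]) => r a b d n x.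
rewrite ltnS leq_eqVlt => /predU1P [-> {n}|lt_n] cl mem_x; last first.
  by apply: in_codes_sub (IH _ _ _ _ _ _ lt_n cl mem_x) => c cL; rewrite mem_cat cL.
have sub t n : n < N -> mtmem [:: t; mnum M n] a b d -> in_codes [:: N.-1, 0 & L] t.
  move=> lt_n mem_t; apply: in_codes_sub (IH _ _ _ _ _ _ lt_n cl mem_t) => c cL.
  by rewrite !inE cL !orbT.
apply: (@in_codes_sub (code_step [:: N.-1, 0 & L])) => [c cL|]; first by rewrite mem_cat cL orbT.
case: (cl _ _ mem_x) => [|[|[|[|//]]]].
- move=> [n [Ex En]]; have {}Ex : x = mpair (mnum M 0) n by [].
  have {}En : mnum M N = sS n by []; rewrite Ex; apply: in_codes_un => //.
  case: N En {IH sub cl mem_x} => [/esym/(mS_neq0 MQ) //|N /(mS_inj MQ) <-].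
  by apply: in_codes_num; rewrite inE eqxx.
- move=> [Ex _]; have -> : x = mpair (mnum M 1) (mnum M 0) by [].
  by apply/in_codes_un/in_codes_num; rewrite // !inE eqxx orbT.
- move=> [l [t [Ht [Ex [El _]]]]].
  have mem_t : mtmem [:: t; l] a b d := Ht.
  have -> : x = mpair (mnum M 2) t by [].
  have /esym/(madd_eq_num MQ) : mnum M N = sadd l (mnum M 3) by [].
  move=> [i [j [E /(mnum_inj MQ) Ej EN]]]; apply: in_codes_un => //.
  by apply: (sub _ i); [lia | rewrite -E].
- move=> [m [l [u [t [Ht [Hu [Ex [El _]]]]]]]].
  have mem_t : mtmem [:: t; l] a b d := Ht.
  have mem_u : mtmem [:: u; m] a b d := Hu.
  have /esym/(madd_eq_num MQ) : mnum M N = sadd (sadd l m) (mnum M 3) by [].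
  move=> [k [k3 [/(madd_eq_num MQ) [i [j [Ei Ej Ek]]] /(mnum_inj MQ) E3 EN]]].
  have ct : in_codes [:: N.-1, 0 & L] t by apply: (sub _ i); [lia | rewrite -Ei].
  have cu : in_codes [:: N.-1, 0 & L] u by apply: (sub _ j); [lia | rewrite -Ej].
  case: Ex => [Ex|[Ex|//]].
    by have -> : x = mpair (mnum M 3) (mpair t u) by []; apply: in_codes_bin.
  by have -> : x = mpair (mnum M 4) (mpair t u) by []; apply: in_codes_bin.
Qed.

Lemma len_fm_codes N : exists L, forall (r : nat -> M) n,
  n < N -> r 1 = mnum M n -> msat r len_fm_f -> in_codes L (r 0).
Proof.
have [Lt LtP] := len_tm_codes N.
have {LtP} LtP n t l (r : nat -> M) : n < N -> meval r l = mnum M n ->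
    msat r (len_tm_f @@ [:: t; l]) -> in_codes Lt (meval r t).
  by move=> lt_n El; rewrite msat_app => /(LtP _ n lt_n); apply.
rewrite /len_fm_f; set st := ors _.
suff [L LP] : exists L, forall (r : nat -> M) a b d n x, n < N ->
    closed_set st r a b d -> mtmem [:: x; mnum M n] a b d -> in_codes L x.
  exists L => r n lt_n r1 /lfp2_elim [a [b [d [cl]]]]; rewrite r1.
  exact: LP lt_n cl.
(* The list [Lt] for terms was obtained for N; keeping K below N lets it serve at every stage of the
   induction. *)
suff : forall K, K <= N -> exists L, forall (r : nat -> M) a b d n x, n < K ->
    closed_set st r a b d -> mtmem [:: x; mnum M n] a b d -> in_codes L x by apply.
elim=> [|K IH] le_KN; first by exists [::].
have {IH} [L IH] := IH (ltnW le_KN).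
(* Here 0 is for the code of [Bot], [Lt] for the two sides of an equation, [L] for shorter
   formulas. *)
exists (L ++ code_step (0 :: Lt ++ L)) => r a b d n x.
rewrite ltnS leq_eqVlt => /predU1P [-> {n}|lt_n] cl mem_x; last first.
  by apply: in_codes_sub (IH _ _ _ _ _ _ lt_n cl mem_x) => c cL; rewrite mem_cat cL.
have sub t n : n < K -> mtmem [:: t; mnum M n] a b d -> in_codes (0 :: Lt ++ L) t.
  move=> lt_n mem_t; apply: in_codes_sub (IH _ _ _ _ _ _ lt_n cl mem_t) => c cL.
  by rewrite inE mem_cat cL !orbT.
have subt t : in_codes Lt t -> @in_codes M (0 :: Lt ++ L) t.
  by apply: in_codes_sub => c cL; rewrite inE mem_cat cL orbT.
apply: (@in_codes_sub (code_step (0 :: Lt ++ L))) => [c cL|]; first by rewrite mem_cat cL orbT.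
case: (cl _ _ mem_x) => [|[|[|[|//]]]].
- move=> [Ex _]; have -> : x = mpair (mnum M 5) (mnum M 0) by [].
  by apply/in_codes_un/in_codes_num; rewrite // inE eqxx.
- move=> [m [l [u [t [Ht [Hu [Ex [El _]]]]]]]].
  have /esym/(madd_eq_num MQ) : mnum M K = sadd (sadd l m) (mnum M 1) by [].
  move=> [k [k1 [/(madd_eq_num MQ) [i [j [Ei Ej Ek]]] /(mnum_inj MQ) E1 EK]]].
  have -> : x = mpair (mnum M 6) (mpair t u) by [].
  by apply: in_codes_bin => //; apply: subt;
    [apply: LtP Ht; last exact: Ei | apply: LtP Hu; last exact: Ej]; lia.
- move=> [m [l [g [f [Hf [Hg [Ex [El _]]]]]]]].
  have mem_f : mtmem [:: f; l] a b d := Hf.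
  have mem_g : mtmem [:: g; m] a b d := Hg.
  have /esym/(madd_eq_num MQ) : mnum M K = sadd (sadd l m) (mnum M 3) by [].
  move=> [k [k3 [/(madd_eq_num MQ) [i [j [Ei Ej Ek]]] /(mnum_inj MQ) E3 EK]]].
  have cf : in_codes (0 :: Lt ++ L) f by apply: (sub _ i); [lia | rewrite -Ei].
  have cg : in_codes (0 :: Lt ++ L) g by apply: (sub _ j); [lia | rewrite -Ej].
  case: Ex => [Ex|[Ex|[Ex|//]]].
  + by have -> : x = mpair (mnum M 7) (mpair f g) by []; apply: in_codes_bin.
  + by have -> : x = mpair (mnum M 8) (mpair f g) by []; apply: in_codes_bin.
  + by have -> : x = mpair (mnum M 9) (mpair f g) by []; apply: in_codes_bin.
- move=> [l [f [Hf [Ex [El _]]]]].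
  have mem_f : mtmem [:: f; l] a b d := Hf.
  have /esym/(madd_eq_num MQ) : mnum M K = sadd l (mnum M 2) by [].
  move=> [i [j [Ei /(mnum_inj MQ) Ej EK]]].
  have cf : in_codes (0 :: Lt ++ L) f by apply: (sub _ i); [lia | rewrite -Ei].
  case: Ex => [Ex|[Ex|//]].
  + by have -> : x = mpair (mnum M 10) f by []; apply: in_codes_un.
  + by have -> : x = mpair (mnum M 11) f by []; apply: in_codes_un.
Qed.

Lemma len_lt_codes N : exists L, forall (r : nat -> M) x z,
  meval r z = mnum M N -> msat r (len_lt x z) -> in_codes L (meval r x).
Proof.
have [L LP] := len_fm_codes N; exists L => r x z Ez [y [len_y /msat_ltf]].
rewrite meval_shift Ez => /(mlt_num MQ) [n lt_n /= Ey].
have {}len_y : msat (scons y r) (len_fm_f @@ [:: shift_tm x; $0]) := len_y.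
move: len_y; rewrite msat_app => /(LP _ n lt_n) /=.
by rewrite meval_shift; apply.
Qed.

End BoundedLength.

Lemma pigeonhole (L : seq nat) (f : nat -> nat) : (forall n, f n \in L) ->
  exists m n, m <> n /\ f m = f n.
Proof.
(* Among the first [size L + 1] arguments, two values of [f] have the same position in [L]. *)
move=> fL; pose g (i : 'I_(size L).+1) := Ordinal (introT idP (etrans (index_mem _ _) (fL i))).
have /injectivePn [i [j ne_ij [E]]] : ~~ injectiveb g.
  by apply/injectiveP => /leq_card; rewrite !card_ord ltnn.
exists i, j; split; first by move=> /val_inj Eij; rewrite Eij eqxx in ne_ij.
by rewrite -(nth_index 0 (fL i)) E nth_index.
Qed.

(** * Berry's paradox *)

Lemma len_numeral n : len_tm (numeral n) = 3 * n + 1.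
Proof. by elim: n => //= n ->; lia. Qed.

Lemma len_Ex A : len_fm (Ex A) = len_fm A + 2. Proof. by []. Qed.
Lemma len_And A B : len_fm (And A B) = len_fm A + len_fm B + 3. Proof. by []. Qed.
Lemma len_Imp A B : len_fm (Imp A B) = len_fm A + len_fm B + 3. Proof. by []. Qed.
Lemma len_All A : len_fm (All A) = len_fm A + 2. Proof. by []. Qed.
Lemma len_Eq t u : len_fm (Eq t u) = len_tm t + len_tm u + 1. Proof. by []. Qed.
Lemma len_Mul t u : len_tm (Mul t u) = len_tm t + len_tm u + 3. Proof. by []. Qed.

Lemma len_ltf_gt t u : 7 < len_fm (ltf t u).
Proof. rewrite /ltf len_Ex len_Eq /=; lia. Qed.

Lemma len_Def_gt tau v u : 13 < len_fm (Def tau v u).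
Proof.
rewrite /Def len_Ex len_And /len_lt len_Ex len_And.
have := len_ltf_gt $0 (shift_tm (shift_tm v)); lia.
Qed.

Lemma len_Berry_gt tau v u : 27 < len_fm (Berry tau v u).
Proof.
rewrite /Berry len_And /Not len_Imp /ball len_All len_Imp.
have := len_Def_gt tau v u; have := len_Def_gt tau (shift_tm v) $0; lia.
Qed.

(** The left side equals [4 * ell tau + 27], so the claim is exactly the bound [27 < ell tau] of
    [len_Berry_gt]. *)
Lemma len_Boolos tau : len_fm (Boolos tau $0) < 5 * ell tau.
Proof.
rewrite /Boolos len_Ex len_And len_Eq /bound len_Mul !len_numeral.
have := len_Berry_gt tau $0 $1; rewrite -/(ell tau).
by move: (ell tau) => l; rewrite /=; lia.
Qed.

(** * Truth of [Def], [Berry] and [Boolos] in a structure *)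

Section Semantics.

Variables (tau : fm) (M : structure).

(** [app] replaces every variable of [F], those beyond the list by [Zero], so the environment
    matters only through the values of the arguments. *)
Lemma msat_app_eq (r r' : nat -> M) F ts ts' :
  (forall i, meval r (nth Zero ts i) = meval r' (nth Zero ts' i)) ->
  msat r (F @@ ts) = msat r' (F @@ ts').
Proof.
by move=> /functional_extensionality E; rewrite !msat_app E.
Qed.

Lemma msat_PrD (r r' : nat -> M) k n k' n' :
  meval r k = meval r' k' -> meval r n = meval r' n' ->
  msat r (PrD tau k n) -> msat r' (PrD tau k' n').
Proof.
move=> Ek En [w [HD [i HP]]]; exists w; split.
  rewrite -(msat_app_eq (r := scons w r) _ (ts := [:: shift_tm k; shift_tm n; $0])) //.
  by move=> [|[|[|j]]] //=; rewrite ?nth_nil ?meval_shift.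
exists i; rewrite -(msat_app_eq (r := scons i (scons w r)) _ (ts := [:: $1; $0])) //.
by move=> [|[|j]] //=; rewrite nth_nil.
Qed.

Lemma msat_len_lt (r r' : nat -> M) x z x' z' :
  meval r x = meval r' x' -> meval r z = meval r' z' ->
  msat r (len_lt x z) -> msat r' (len_lt x' z').
Proof.
move=> Ex Ez [l [Hl /msat_ltf lt_l]]; exists l; split.
  rewrite -(msat_app_eq (r := scons l r) _ (ts := [:: shift_tm x; $0])) //.
  by move=> [|[|j]] //=; rewrite ?nth_nil ?meval_shift.
by apply/msat_ltf; move: lt_l; rewrite !meval_shift Ez.
Qed.

Lemma msat_Def_imp (r r' : nat -> M) z y z' y' :
  meval r z = meval r' z' -> meval r y = meval r' y' ->
  msat r (Def tau z y) -> msat r' (Def tau z' y').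
Proof.
move=> Ez Ey [x [Hl HP]]; exists x; split.
  by apply: msat_len_lt Hl; rewrite ?meval_shift.
by apply: msat_PrD HP; rewrite ?meval_shift.
Qed.

Lemma msat_Def (r r' : nat -> M) z y z' y' :
  meval r z = meval r' z' -> meval r y = meval r' y' ->
  msat r (Def tau z y) <-> msat r' (Def tau z' y').
Proof. by move=> Ez Ey; split; apply: msat_Def_imp. Qed.

Lemma msat_Berry (r : nat -> M) v u : msat r (Berry tau v u) <->
  ~ msat r (Def tau v u) /\
  forall y, mlt y (meval r u) -> msat (scons y r) (Def tau (shift_tm v) $0).
Proof. by rewrite -msat_ball. Qed.

Hypothesis MQ : model M Q.

Definition definable (x : M) : Prop := msat (fun _ => x) (Def tau (bound tau) $0).

Lemma meval_bound (r : nat -> M) : meval r (bound tau) = mnum M (5 * ell tau).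
Proof.
have -> : meval r (bound tau) = smul (meval r (numeral 5)) (meval r (numeral (ell tau))).
  exact: erefl.
rewrite !meval_numeral; exact: mnum_mul.
Qed.

Lemma msat_Def_bound (r : nat -> M) t :
  msat r (Def tau (bound tau) t) <-> definable (meval r t).
Proof. by apply: msat_Def; rewrite ?meval_bound. Qed.

Lemma msat_Boolos (r : nat -> M) t : msat r (Boolos tau t) <->
  ~ definable (meval r t) /\ forall y, mlt y (meval r t) -> definable y.
Proof.
have E : msat r (Boolos tau t) = exists v, v = meval (scons v r) (bound tau) /\
  msat (scons v r) (Berry tau $0 (shift_tm t)) by [].
pose N := mnum M (5 * ell tau).
have B : msat (scons N r) (Berry tau $0 (shift_tm t)) <->
    ~ definable (meval r t) /\ forall y, mlt y (meval r t) -> definable y.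
  rewrite msat_Berry meval_shift; have D x : (msat (scons x (scons N r)) (Def tau $1 $0)) <->
    definable x by apply: msat_Def; rewrite ?meval_bound.
  have -> : msat (scons N r) (Def tau $0 (shift_tm t)) <-> definable (meval r t).
    by apply: msat_Def; rewrite ?meval_bound ?meval_shift.
  split=> -[nD lD]; split; [exact: nD | | exact: nD |] => y lt_y.
    exact: (D y).1 (lD y lt_y).
  exact: (D y).2 (lD y lt_y).
rewrite E -B; split=> [[v []]|HB]; first by rewrite meval_bound => ->; exact: id.
exists N; split; [by rewrite meval_bound | exact: HB].
Qed.

End Semantics.

(** * Existence of a number not provably definable *)

Lemma extends_model T (M : structure) : extends T Q -> model M T -> model M Q.
Proof. by move=> T_Q MT A QA; apply: soundness MT (T_Q _ (pAx QA)). Qed.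

Lemma undefinable_ex T tau :
  extends T Q ->
  (forall m n k : nat,
     prv T (Imp (And (PrD tau (numeral k) (numeral m))
                     (And (PrD tau (numeral k) (numeral n))
                          (Not (Eq (numeral m) (numeral n)))))
                (Not (Con tau)))) ->
  consistent (add_axiom T (Con tau)) ->
  exists b, ~ prv T (Def tau (bound tau) (numeral b)).
Proof.
move=> T_Q uniq /consistent_model [M MT']; apply: NNPP => nex.
have MT : model M T by move=> A TA; apply: MT'; left.
have MQ := extends_model T_Q MT.
pose r : nat -> M := fun _ => s0 M.
have [L LP] := len_lt_codes MQ (5 * ell tau).
(* The witness of [Def] is an element of [M]; replacing it by a standard k is what brings it under
   the uniqueness hypothesis. *)
have def n : exists k, k \in L /\ msat r (PrD tau (numeral k) (numeral n)).
  have pD : prv T (Def tau (bound tau) (numeral n)).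
    by apply: NNPP => nD; apply: nex; exists n.
  have [x [Hl HP]] : exists x, msat (scons x r) (len_lt $0 (shift_tm (bound tau))) /\
      msat (scons x r) (PrD tau $0 (shift_tm (numeral n))) := soundness MT pD r.
  have Ez : meval (scons x r) (shift_tm (bound tau)) = mnum M (5 * ell tau).
    by rewrite meval_shift meval_bound.
  have [k kL Ex] := LP (scons x r) _ _ Ez Hl.
  exists k; split; [exact: kL | apply: msat_PrD HP; last exact: meval_shift].
  by rewrite meval_numeral -Ex.
pose f n := sval (constructive_indefinite_description _ (def n)).
have fP n : f n \in L /\ msat r (PrD tau (numeral (f n)) (numeral n)).
  exact: svalP (constructive_indefinite_description _ (def n)).
have [m [n [ne_mn E]]] := pigeonhole (fun n => (fP n).1).
have nCon : msat r (PrD tau (numeral (f m)) (numeral m)) /\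
    msat r (PrD tau (numeral (f m)) (numeral n)) /\
    meval r (numeral m) <> meval r (numeral n) -> ~ msat r (Con tau) :=
  soundness MT (uniq m n (f m)) r.
apply: nCon; last by apply: MT'; right.
split; first exact: (fP m).2.
split; first by rewrite E; exact: (fP n).2.
by rewrite !meval_numeral => /(mnum_inj MQ).
Qed.

Lemma least_counterexample (P : nat -> Prop) n : ~ P n ->
  exists b, ~ P b /\ forall y, y < b -> P y.
Proof.
elim/ltn_ind: n => n IH nP; have [H|/not_all_ex_not [y]] := classic (forall y, y < n -> P y).
  by exists n.
by move=> nPy; have [lt_y] := imply_to_and _ _ nPy; apply: IH.
Qed.

Lemma prv_DefP T tau n : extends T Q ->
  prv T (Def tau (bound tau) (numeral n)) <->
  forall M : structure, model M T -> definable tau (mnum M n).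
Proof.
move=> T_Q; split=> [pD M MT|H].
  have MQ := extends_model T_Q MT; rewrite -(meval_numeral (fun _ => s0 M)).
  exact: (msat_Def_bound tau MQ _ _).1 (soundness MT pD _).
apply: completeness => M MT r; have MQ := extends_model T_Q MT.
apply: (msat_Def_bound tau MQ _ _).2; rewrite meval_numeral; exact: H.
Qed.

Section Least.

Variables (T : theory) (tau : fm) (b : nat).
Hypotheses (T_Q : extends T Q) (tauP : presents tau T).
Hypothesis b_undef : ~ prv T (Def tau (bound tau) (numeral b)).
Hypothesis lt_b_def : forall y, y < b -> prv T (Def tau (bound tau) (numeral y)).

Lemma lt_b_definable (M : structure) (y : M) :
  model M T -> mlt y (mnum M b) -> definable tau y.
Proof.
move=> MT /(mlt_num (extends_model T_Q MT)) [k /lt_b_def pk ->].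
exact: (prv_DefP tau k T_Q).1 pk M MT.
Qed.

Lemma prv_D_Boolos : prv T (Not (Def tau (bound tau) (numeral b))) ->
  prv T (D_fm (Boolos tau $0) b).
Proof.
move=> pN; apply: completeness => M MT r x; have MQ := extends_model T_Q MT.
have nb : ~ definable tau (mnum M b).
  rewrite -(meval_numeral r) => db.
  exact: (soundness MT pN r) ((msat_Def_bound tau MQ r _).2 db).
have Bx : msat (scons x r) (diag (Boolos tau $0)) <->
    ~ definable tau x /\ forall y, mlt y x -> definable tau y.
  rewrite /diag msat_subst; exact: msat_Boolos.
suff H : msat (scons x r) (diag (Boolos tau $0)) <->
    x = meval (scons x r) (numeral b) by exact: conj H.1 H.2.
rewrite Bx meval_numeral; split=> [[nx lt_x]|->].
  (* An [x] below b is definable because b is least; an [x] above b would make b definable. This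
     comparison is legitimate since b is standard. *)
  case: (mlt_total MQ x b) => [lt_xb|[//|/lt_x db]].
    by case: (nx (lt_b_definable MT lt_xb)).
  by case: (nb db).
split; [exact: nb | move=> y; exact: lt_b_definable].
Qed.

(** The proof of [D_fm A b] really exists, so [Def] is true in [natM]; it then holds in every model
    of [T] by [upward_Def]. *)
Lemma prv_Def_of_D A : prv T (D_fm A b) -> len_fm A < 5 * ell tau ->
  prv T (Def tau (bound tau) (numeral b)).
Proof.
move=> pD lt_A; apply: (prv_DefP tau b T_Q).2 => M MT.
have MQ := extends_model T_Q MT.
have sD : @msat natM (fun _ => 0) (Def tau (bound tau) (numeral b)).
  apply: Def_true tauP pD _ _; first exact: nat_numeral.
  rewrite (meval_bound _ natM_Q) mnum_nat; exact: lt_A.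
have := (msat_Def_bound tau MQ _ _).1 (upward_Def tauP MQ sD).
rewrite meval_numeral; exact: id.
Qed.

Lemma nprv_not_Def : ~ prv T (Not (Def tau (bound tau) (numeral b))).
Proof.
move=> /prv_D_Boolos pD; apply: b_undef; apply: prv_Def_of_D pD _; exact: len_Boolos.
Qed.

Lemma independent_not_Def : independent T (Not (Def tau (bound tau) (numeral b))).
Proof.
split; first exact: nprv_not_Def.
move=> pNN; exact: b_undef (pMP (pLog _ (lDN _)) pNN).
Qed.

Lemma independent_Boolos : independent T (Boolos tau (numeral b)).
Proof.
split=> pB.
  apply: nprv_not_Def; apply: completeness => M MT r; have MQ := extends_model T_Q MT.
  have [nD _] := (msat_Boolos tau MQ _ _).1 (soundness MT pB r).
  move=> sD; exact: nD ((msat_Def_bound tau MQ _ _).1 sD).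
apply: b_undef; apply: (prv_DefP tau b T_Q).2 => M MT; have MQ := extends_model T_Q MT.
apply: NNPP => nD; apply: (soundness MT pB (fun _ => s0 M)).
apply: (msat_Boolos tau MQ _ _).2; rewrite meval_numeral.
split; [exact: nD | move=> y; exact: lt_b_definable].
Qed.

End Least.

Theorem theorem4p7 (T : theory) (tau : fm)
    (T_re : re_theory T) (tauP : presents tau T) (T_Q : extends T Q)
    (PrD_unique : forall m n k : nat,
        prv T (Imp (And (PrD tau (numeral k) (numeral m))
                        (And (PrD tau (numeral k) (numeral n))
                             (Not (Eq (numeral m) (numeral n)))))
                   (Not (Con tau))))
    (T_Con : consistent (add_axiom T (Con tau))) :
  exists b : nat,
    independent T (Not (Def tau (bound tau) (numeral b))) /\
    independent T (Boolos tau (numeral b)).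
Proof.
have [n n_undef] := undefinable_ex T_Q PrD_unique T_Con.
have [b [b_undef lt_b]] :=
  least_counterexample (P := fun n => prv T (Def tau (bound tau) (numeral n))) n_undef.
exists b; split; first exact: independent_not_Def.
exact: independent_Boolos.
Qed.
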